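(* Let $\varphi$ be a (locally faithful) Markov state on the Fermion algebra $\mathfrak{A}$, with associated sequence of conditional expectations $\{\mathcal{E}_j\}_{j_-\le j<j_+}$. Let $\Omega$ be the associated compact space, $\mu$ the associated probability measure on $\Omega$, and, for each $\omega\in\Omega$, let $\mathfrak{B}^{\omega}$, $E^{\omega}:\mathfrak{A}\to\mathfrak{B}^{\omega}$ and $\psi^{\omega}\in\mathcal{S}(\mathfrak{B}^{\omega})$ be the associated quasi local algebra, map and state (all defined in the context). Then $\varphi$ admits the integral decomposition $$\varphi(A)=\int_{\Omega}\psi^{\omega}\circ E^{\omega}(A)\,\mu(d\omega),\qquad A\in\mathfrak{A}.$$
   Context: Fermion algebra. $I$ is a countable totally ordered set order isomorphic to $\mathbb{Z}$, $\mathbb{Z}_-$, $\mathbb{Z}_+$ or a finite interval; $j_-$, $j_+$ are its smallest and greatest elements if they exist; otherwise $j_-=-\infty$ and/or $j_+=+\infty$ and objects carrying these indices are omitted. For $j\in I$, $\mathfrak{A}_{\{j\}}$ is generated by $d_j$ annihilators $a_{j,1},\dots,a_{j,d_j}$ and their adjoints, all generators (also on different sites) satisfying the canonical anticommutation relations $\{a_{j,i}^*,a_{k,h}\}=\delta_{jk}\delta_{ih}1$, $\{a_{j,i},a_{k,h}\}=0$. For $\Lambda\subset I$, $\mathfrak{A}_\Lambda$ is the $C^*$-algebra generated by $\mathfrak{A}_{\{j\}}$, $j\in\Lambda$, and $\mathfrak{A}=\mathfrak{A}_I$. Put $[k,n]=\{l\in I: k\le l\le n\}$, $n]=\{l\in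 I:l\le n\}$, $\mathfrak{A}_{j_--1]}=\mathbb{C}1$, and $\varphi_\Lambda=\varphi|_{\mathfrak{A}_\Lambda}$. $\Theta$ is the parity automorphism, $\Theta(a_{j,i})=-a_{j,i}$; $\mathfrak{A}_+$ (even elements) and $\mathfrak{A}_-$ (odd elements) are its $\pm1$ eigenspaces. Maps commuting with $\Theta$, and $\Theta$-invariant states, are called even. A state is locally faithful if $\varphi_\Lambda$ is faithful for all finite $\Lambda$. Markov states. A quasi conditional expectation with respect to unital $C^*$-algebras $\mathfrak{C}\subset\mathfrak{B}\subset\mathfrak{D}$ is a completely positive unital map $E:\mathfrak{D}\to\mathfrak{B}$ with $E(ca)=cE(a)$ for $c\in\mathfrak{C}$, $a\in\mathfrak{D}$. A conditional expectation is a norm one projection onto a $C^*$-subalgebra with the same identity. An even state $\varphi$ on $\mathfrak{A}$ is a Markov state if for each $n<j_+$ there is an even quasi conditional expectation $E_n$ with respect to $\mathfrak{A}_{n-1]}\subset\mathfrak{A}_{n]}\subset\mathfrak{A}_{n+1]}$ with $\varphi_{n]}\circ E_n=\varphi_{n+1]}$ and $E_n(\mathfrak{A}_{[n,n+1]})\subset\mathfrak{A}_{\{n\}}$. For $\varphi$ locally faithful (a standing assumption), with $e_n:=E_n|_{\mathfrak{A}_{[n,n+1]}}$, the ergodic average $\varepsilon_n:=\lim_k\frac1k\sum_{h=0}^{k-1}e_n^h$ is an even conditional expectation of $\mathfrak{A}_{[n,n+1]}$ onto its range $\mathcal{R}(\varepsilon_n)\subset\mathfrak{A}_{\{n\}}$;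 $\{\varepsilon_n\}$ are the transition expectations of $\varphi$, and $\mathcal{E}_n:\mathfrak{A}_{n+1]}\to\mathfrak{A}_{n]}$ is determined by $\mathcal{E}_n(xy)=x\varepsilon_n(y)$, $x\in\mathfrak{A}_{n-1]}$, $y\in\mathfrak{A}_{[n,n+1]}$. Associated objects. For $j<j_+$, let $\{P^j_{\gamma}\}_{\gamma\in\Gamma_j}$ be the minimal projections of the centre of $\mathcal{R}(\varepsilon_j)$. $\Theta$ permutes them; let $\Omega_j=\Gamma_j/\sim$ be the set of $\Theta$-orbits and, for $\omega_j\in\Omega_j$, let $Q^j_{\omega_j}$ be the sum of the $P^j_\gamma$ with $\gamma$ in the orbit $\omega_j$. If $j_+\in I$ put $\Omega_{j_+}=\{j_+\}$, $Q^{j_+}_{j_+}=1$. Put $\Omega=\prod_{j\in I}\Omega_j$ (product topology). The $Q^j_{\omega_j}$ are even, so those on different sites commute. - $\mu$ is the law on $\Omega$ of the Markov process with marginals $\pi^j_{\omega_j}=\varphi(Q^j_{\omega_j})$ and transition probabilities $\pi^j_{\omega_j,\omega_{j+1}}=\varphi(\varepsilon_j(Q^j_{\omega_j}Q^{j+1}_{\omega_{j+1}}))/\varphi(Q^j_{\omega_j})$, $j<j_+$. - For $\omega\in\Omega$ and finite $\Lambda\subset I$ let $Q^\omega_\Lambda=\prod_{j\in\Lambda}Q^j_{\omega_j}$ and $\mathfrak{B}^\omega_\Lambda=Q^\omega_\Lambda\mathfrak{A}_\Lambda Q^\omega_\Lambda$ (generated, inside this corner, by the $Q^j_{\omega_j}\mathfrak{A}_{\{j\}}Q^j_{\omega_j}$,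 $j\in\Lambda$). For $\Lambda\subset\Lambda'$ embed unitally $\mathfrak{B}^\omega_\Lambda\to\mathfrak{B}^\omega_{\Lambda'}$ by $b\mapsto bQ^\omega_{\Lambda'\setminus\Lambda}$; $\mathfrak{B}^\omega$ is the $C^*$-inductive limit, and $\mathfrak{B}^\omega_\Lambda$ for infinite $\Lambda$ is the corresponding closed subalgebra. - $E^\omega:\mathfrak{A}\to\mathfrak{B}^\omega$ is the completely positive unital map determined by $E^\omega(x_{j_1}\cdots x_{j_n})=(Q^{j_1}_{\omega_{j_1}}x_{j_1}Q^{j_1}_{\omega_{j_1}})\cdots(Q^{j_n}_{\omega_{j_n}}x_{j_n}Q^{j_n}_{\omega_{j_n}})$ for $x_{j_i}\in\mathfrak{A}_{\{j_i\}}$ on distinct sites; that is, $E^\omega(x)=Q^\omega_\Lambda xQ^\omega_\Lambda$ for $x\in\mathfrak{A}_\Lambda$, $\Lambda$ finite. - $\mathcal{E}^\omega_j:\mathfrak{B}^\omega_{j+1]}\to\mathfrak{B}^\omega_{j]}$ is given by $\mathcal{E}^\omega_j(xy)=x\varepsilon_j(y)/\pi^j_{\omega_j,\omega_{j+1}}$ for $x\in\mathfrak{B}^\omega_{j-1]}$, $y\in\mathfrak{B}^\omega_{[j,j+1]}$. - $\psi^\omega$ is the state on $\mathfrak{B}^\omega$ determined on localized elements by $\psi^\omega=\lim_{k\downarrow j_-,\,l\uparrow j_+}\frac{1}{\pi^k_{\omega_k}}\,\varphi|_{Q^k_{\omega_k}\mathfrak{A}_{\{k\}}Q^k_{\omega_k}}\circ\mathcal{E}^\omega_k\circ\cdots\circ\mathcal{E}^\omega_l$.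 *)

(* Defs.v *)
From HB Require Import structures.
From mathcomp Require Import all_boot all_order all_algebra finmap complex.
From mathcomp Require Import all_classical all_reals all_analysis.

Set Implicit Arguments.
Unset Strict Implicit.
Unset Printing Implicit Defensive.

Import Order.TTheory GRing.Theory Num.Theory.
Import numFieldNormedType.Exports.

Local Open Scope classical_set_scope.
Local Open Scope complex_scope.
Local Open Scope ring_scope.

(** * C*-algebras *)

(* The norm is kept outside the library hierarchy of normed modules: no
   structure there joins normed modules and noncommutative rings. *)
HB.mixin Record isCStar (R : realType) A & GRing.Algebra R[i] A := {
  star : A -> A ;
  cnorm : A -> R ;
  starK : involutive star ;
  starD : forall x y : A, star (x + y) = star x + star y ;
  starZ : forall (c : R[i]) (x : A), star (c *: x) = c^* *: star x ;
  starM : forall x y : A, star (x * y) = star y * star x ;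
  cnorm0_eq0 : forall x : A, cnorm x = 0 -> x = 0 ;
  cnormD : forall x y : A, cnorm (x + y) <= cnorm x + cnorm y ;
  cnormZ : forall (c : R[i]) (x : A),
    (cnorm (c *: x))%:C = `|c| * (cnorm x)%:C ;
  cnormM : forall x y : A, cnorm (x * y) <= cnorm x * cnorm y ;
  cnorm_starM : forall x : A, cnorm (star x * x) = cnorm x ^+ 2 ;
  cnorm_complete : forall u : nat -> A,
    (forall e : R, 0 < e -> exists N, forall m n, (N <= m)%N -> (N <= n)%N ->
       cnorm (u m - u n) < e) ->
    exists l : A, (fun n => cnorm (u n - l)) @ \oo --> (0 : R)
}.

#[short(type="cstarType")]
HB.structure Definition CStar (R : realType) :=
  { A of GRing.Algebra R[i] A & isCStar R A }.

Section CStarNotions.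
Variables (R : realType) (A : cstarType R).

Definition norm_cvg (u : nat -> A) (l : A) : Prop :=
  (fun n => cnorm (u n - l)) @ \oo --> (0 : R).

Definition norm_closed (S : set A) : Prop :=
  forall (u : nat -> A) (l : A), (forall n, S (u n)) -> norm_cvg u l -> S l.

Definition norm_dense (S : set A) : Prop :=
  forall (x : A) (e : R), 0 < e -> exists2 y, S y & cnorm (x - y) < e.

(* Unital C*-subalgebras, with the identity of A. *)
Definition cstar_subalg (S : set A) : Prop :=
  [/\ norm_closed S, S 1,
      forall (c : R[i]) (x y : A), S x -> S y -> S (c *: x + y),
      forall x y : A, S x -> S y -> S (x * y)
    & forall x : A, S x -> S (star x)].

Definition cstar_gen (G : set A) : set A :=
  [set x | forall S, cstar_subalg S -> G `<=` S -> S x].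

Definition center_of (S : set A) : set A :=
  [set z | S z /\ forall y, S y -> z * y = y * z].

Definition is_projection (p : A) : Prop := star p = p /\ p * p = p.

Definition minimal_projection (S : set A) (p : A) : Prop :=
  [/\ S p, is_projection p, p != 0
    & forall q, S q -> is_projection q -> q * p = q -> q = 0 \/ q = p].

(* Positive functionals of norm one. *)
Definition is_state (phi : A -> R[i]) : Prop :=
  [/\ scalar phi, forall x, `|phi x| <= (cnorm x)%:C, phi 1 = 1
    & forall x, 0 <= phi (star x * x)].

Definition faithful_on (S : set A) (phi : A -> R[i]) : Prop :=
  forall x, S x -> phi (star x * x) = 0 -> x = 0.

Definition linear_on (V : lmodType R[i]) (S : set A) (f : A -> V) : Prop :=
  forall (c : R[i]) (x y : A), S x -> S y -> f (c *: x + y) = c *: f x + f y.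

Definition mxstar n (X : 'M[A]_n) : 'M[A]_n := map_mx star X^T.

(* Norm one projections of D onto the subalgebra f @` D. *)
Definition cond_expectation (D : set A) (f : A -> A) : Prop :=
  [/\ linear_on D f, cstar_subalg (f @` D), f @` D `<=` D,
      forall x, D x -> f (f x) = f x
    & forall x, D x -> cnorm (f x) <= cnorm x].

End CStarNotions.

(* Complete positivity of f : D -> S, the positive elements of a matrix algebra
   M_n(D) being those of the form Y^* Y with Y in M_n(D). *)
Definition cp_on (R : realType) (A B : cstarType R) (D : set A) (S : set B)
    (f : A -> B) : Prop :=
  forall n (X : 'M[A]_n), (forall i j, D (X i j)) ->
    exists2 Y : 'M[B]_n, (forall i j, S (Y i j)) &
      map_mx f (mxstar X *m X) = mxstar Y *m Y.

Definition quasi_cond_expectation (R : realType) (A : cstarType R)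
    (C B D : set A) (f : A -> A) : Prop :=
  [/\ linear_on D f, forall x, D x -> B (f x), cp_on D B f, f 1 = 1
    & forall c x, C c -> D x -> f (c * x) = c * f x].

(** * The Fermion algebra *)

(* The index set is an interval of int: a nonempty [interval int] is Z, a
   half-line or a finite interval.  The values of [deg] and [ann] at sites
   outside the index set are irrelevant. *)
Record fermion (R : realType) (A : cstarType R) := Fermion {
  sites : interval int ;
  sites_neq0 : exists j, j \in sites ;
  deg : int -> nat ;
  ann : forall j : int, 'I_(deg j) -> A ;
  car_star : forall j k (i : 'I_(deg j)) (h : 'I_(deg k)),
    j \in sites -> k \in sites ->
    star (ann i) * ann h + ann h * star (ann i)
      = if (j == k) && (i == h :> nat) then 1 else 0 ;
  car_ann : forall j k (i : 'I_(deg j)) (h : 'I_(deg k)),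
    j \in sites -> k \in sites -> ann i * ann h + ann h * ann i = 0 ;
  car_gen : cstar_gen [set x | exists2 j, j \in sites &
                               exists i : 'I_(deg j), x = ann i] = setT ;
  parity : A -> A ;
  parity_linear : linear parity ;
  parity_mul : forall x y, parity (x * y) = parity x * parity y ;
  parity_star : forall x, parity (star x) = star (parity x) ;
  parity_norm : forall x, cnorm (parity x) = cnorm x ;
  parity_bij : bijective parity ;
  parity_ann : forall j (i : 'I_(deg j)), j \in sites ->
    parity (ann i) = - ann i
}.

Section MarkovStates.
Variables (R : realType) (A : cstarType R) (F : fermion A).
Local Notation I := (sites F).
Local Notation Theta := (parity F).

(* n belongs to I and n < j_+ *)
Definition lt_jmax (n : int) : bool := (n \in I) && (n + 1 \in I).

Definition alg (S : set int) : set A :=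
  cstar_gen [set x | exists j, [/\ S j, j \in I &
                               exists i : 'I_(deg F j), x = ann i]].

(* For n = j_- the algebra [alg_le (n - 1)] is C1. *)
Definition alg_le (n : int) : set A := alg [set j | j <= n].
Definition alg_seg (k n : int) : set A := alg [set j | k <= j <= n].

Definition even_state (phi : A -> R[i]) : Prop :=
  is_state phi /\ forall x, phi (Theta x) = phi x.

Definition locally_faithful (phi : A -> R[i]) : Prop :=
  forall L : {fset int}, faithful_on (alg [set` L]) phi.

(* phi is a Markov state, the E_n being its quasi conditional expectations. *)
Definition markov_state_with (phi : A -> R[i]) (E : int -> A -> A) : Prop :=
  even_state phi /\ forall n, lt_jmax n ->
    [/\ quasi_cond_expectation (alg_le (n - 1)) (alg_le n) (alg_le (n + 1))
          (E n),
        forall x, alg_le (n + 1) x -> E n (Theta x) = Theta (E n x),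
        forall x, alg_le (n + 1) x -> phi (E n x) = phi x
      & forall x, alg_seg n (n + 1) x -> alg_seg n n (E n x)].

Definition transition_expectations (E eps : int -> A -> A) : Prop :=
  forall n, lt_jmax n -> forall x, alg_seg n (n + 1) x ->
    norm_cvg (fun k => (k.+1%:R : R[i])^-1 *: \sum_(h < k.+1) iter h (E n) x)
             (eps n x).

Definition markov_cond_expectations (eps calE : int -> A -> A) : Prop :=
  forall n, lt_jmax n ->
    [/\ cond_expectation (alg_le (n + 1)) (calE n),
        forall x, alg_le (n + 1) x -> alg_le n (calE n x)
      & forall x y, alg_le (n - 1) x -> alg_seg n (n + 1) y ->
          calE n (x * y) = x * eps n y].

End MarkovStates.

(** * The space Omega and the Markov process *)

(* Measurable types are pointed, so Omega is realized as a subset of the space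
   of all sequences of labels, with the Borel sets of the product topology. *)
Section Paths.
Variables (R : realType) (A : cstarType R).

Definition seq_space : Type :=
  prod_topology (fun _ : int => discrete_topology (set A)).
HB.instance Definition _ := Topological.on seq_space.
HB.instance Definition _ := Pointed.copy seq_space (int -> set A).

Definition paths : Type := g_sigma_algebraType (@open seq_space).
HB.instance Definition _ := Measurable.on paths.

End Paths.

Section Decomposition.
Variables (R : realType) (A : cstarType R) (F : fermion A).
Variables (phi : A -> R[i]) (eps calE : int -> A -> A).
Local Notation I := (sites F).
Local Notation Theta := (parity F).

Definition central_atoms (j : int) : set A :=
  minimal_projection (center_of (eps j @` alg_seg F j (j + 1))).

(* Omega_j, as the set of the Theta-orbits {P, Theta P} (Theta is an
   involution).  For j = j_+ it is the singleton of the label {1}, for which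
   [Qproj] is 1; the same one-point factor is put at the j outside I, so that
   the product of the Omega_j over int is the product over I. *)
Definition Omega_ (j : int) : set (set A) :=
  if lt_jmax F j then [set [set P; Theta P] | P in central_atoms j]
  else [set [set 1]].

Definition Omega : set (paths A) := [set w | forall j, Omega_ j (w j)].

Definition Qproj (o : set A) : A := \sum_(P \in o) P.

Definition marginal (o : set A) : R[i] := phi (Qproj o).

Definition transition (j : int) (o o' : set A) : R[i] :=
  phi (eps j (Qproj o * Qproj o')) / phi (Qproj o).

Definition markov_law (mu : probability (paths A) R) : Prop :=
  mu Omega = 1%E /\
  forall (v : paths A) (k n : int),
    Omega v -> k \in I -> n \in I -> k <= n ->
    mu (Omega `&` [set w : paths A | forall j, k <= j <= n -> w j = v j]) =
    (complex.Re (marginal (v k) *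
       \prod_(i < absz (n - k))
         transition (k + i%:Z) (v (k + i%:Z)) (v (k + i%:Z + 1))))%:E.

(** * The quasi local algebras, maps and states over Omega *)

Definition finite_sites (L : {fset int}) : Prop := forall j, j \in L -> j \in I.

Definition seg (k n : int) : {fset int} :=
  [fset (k + i%:Z)%R | i in iota 0 (absz (n - k)).+1]%fset.

Section Fibre.
Variable w : paths A.

(* The factors commute, so their order does not matter. *)
Definition Qprod (L : {fset int}) : A := \prod_(j <- L) Qproj (w j).

Definition corner (L : {fset int}) : set A :=
  [set Qprod L * x * Qprod L | x in alg F [set` L]].

(* B, with the maps io L : corner L -> B, is the C*-inductive limit of the
   corners (it is unique up to isomorphism). *)
Definition inductive_limit (B : cstarType R) (io : {fset int} -> A -> B)
    : Prop :=
  [/\ forall L, finite_sites L ->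
        [/\ linear_on (corner L) (io L),
            forall b c, corner L b -> corner L c ->
              io L (b * c) = io L b * io L c,
            forall b, corner L b -> io L (star b) = star (io L b),
            io L (Qprod L) = 1
          & forall b, corner L b -> cnorm (io L b) = cnorm b],
      forall L L' b, finite_sites L' -> (L `<=` L')%fset -> corner L b ->
        io L' (b * Qprod (L' `\` L)%fset) = io L b
    & norm_dense [set y : B | exists2 L, finite_sites L &
                              exists2 b, corner L b & y = io L b]].

(* The contractivity, automatic for a completely positive unital map, makes
   explicit that f is determined by its values on localized elements. *)
Definition corner_map (B : cstarType R) (io : {fset int} -> A -> B)
    (f : A -> B) : Prop :=
  [/\ linear f, f 1 = 1, cp_on setT setT f, forall x, cnorm (f x) <= cnorm x
    & forall L x, finite_sites L -> alg F [set` L] x ->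
        f x = io L (Qprod L * x * Qprod L)].

(* As calE_j (x y) = x eps_j(y), this maps x y to x eps_j(y) / pi_j; it is 0
   if pi_j = 0, by the convention 0^-1 = 0. *)
Definition fibre_exp (j : int) (b : A) : A :=
  (transition j (w j) (w (j + 1)))^-1 *: calE j b.

(* calE^w_k o calE^w_(k+1) o ... o calE^w_(k+m-1) *)
Fixpoint fibre_comp (k : int) (m : nat) (b : A) : A :=
  if m is m'.+1 then fibre_comp k m' (fibre_exp (k + m'%:Z) b) else b.

Definition local_psi (k n : int) (b : A) : R[i] :=
  phi (fibre_comp k (absz (n - k)) b) / marginal (w k).

Definition nondegenerate : Prop :=
  forall j, lt_jmax F j -> transition j (w j) (w (j + 1)) != 0.

(* psi is the bounded functional on B whose values on localized elements are
   the limits, as k decreases to j_- and n increases to j_+, of [local_psi k n]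
   on the images in the corner of [k, n].  It is a state if w has no vanishing
   transition probability; the other w form a mu-negligible set, on which the
   convention 0^-1 = 0 makes psi vanish. *)
Definition fibre_state (B : cstarType R) (io : {fset int} -> A -> B)
    (psi : B -> R[i]) : Prop :=
  [/\ scalar psi, forall b, `|psi b| <= (cnorm b)%:C,
      nondegenerate -> is_state psi
    & forall L b, finite_sites L -> corner L b ->
      forall e : R, 0 < e -> exists k0 n0, [/\ k0 \in I, n0 \in I &
        forall k n, k \in I -> n \in I -> k <= k0 -> n0 <= n -> k <= n ->
          (L `<=` seg k n)%fset ->
          `|local_psi k n (b * Qprod (seg k n `\` L)%fset) - psi (io L b)|
            < e%:C]].

End Fibre.

Definition complex_integrable (mu : probability (paths A) R)
    (f : paths A -> R[i]) : Prop :=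
  mu.-integrable Omega (fun w => (complex.Re (f w))%:E) /\
  mu.-integrable Omega (fun w => (complex.Im (f w))%:E).

Definition complex_integral (mu : probability (paths A) R)
    (f : paths A -> R[i]) : R[i] :=
  (\int[mu]_(w in Omega) complex.Re (f w)) +i*
  (\int[mu]_(w in Omega) complex.Im (f w)).

End Decomposition.

(* Main.v *)
Require Import Defs.
From mathcomp Require Import all_boot all_order all_algebra finmap complex.
From mathcomp Require Import all_classical all_reals all_analysis.
From mathcomp Require Import ring lra zify measurable_realfun.
Set Implicit Arguments.
Unset Strict Implicit.
Unset Printing Implicit Defensive.

Import Order.TTheory GRing.Theory Num.Theory.
Import numFieldNormedType.Exports.

Local Open Scope classical_set_scope.
Local Open Scope complex_scope.
Local Open Scope ring_scope.

(** Why the decomposition holds.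

Let [x] be localized in a segment [[k, n]] of the sites, let [w] be a path, and
let [q] be the product of the orbit projections selected by [w] on that
segment.  The state of the fibre over [w] is a limit of functionals which
apply successive maps [calE] to [q x q], and then [phi], and divide by the
marginal and by the transition probabilities.  Since [phi] is invariant under
[calE] ([phi_calE]), such a functional has the value [phi (q x q)] divided by
the weight of the path ([local_psiE]), and this weight is the mass that [mu]
gives to the cylinder of [w] over the segment ([mu_cylinder]).  Integrating
over the finitely many cylinders thus leaves the sum of the [phi (q x q)], and
this sum is [phi x]: the projections of one site add up to 1 ([sum_Qproj]) and
lie in the centralizer of [phi] ([phi_center_commute]), so that cutting by them
does not change [phi] ([phi_pinching]).

The integrals of the approximating functionals are therefore all equal to
[phi x] ([integral_cut_psi]), and it remains to pass to the limit.  By the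
Markov property ([phi_Qlist]) the weight of a path is [phi q], so the
approximating functionals are bounded by the norm of [x] ([cut_psi_le]) and
dominated convergence applies.  The localized elements are dense, and a second
dominated convergence extends the formula to all elements ([decomposition]).

The work is in the structure of the transition expectations [eps].

- A fixed point of a completely positive map that preserves a faithful state
  belongs to its multiplicative domain ([fixed_mull]), and the ergodic averages
  converge to fixed points ([f_eps]).  Hence [eps] is a bimodule map over its
  range, a *-algebra.

- Elements of disjoint regions commute up to parity ([graded_commutation]), so
  the products [x y] on which [calE] is determined span a dense *-algebra
  ([alg_le_ind]).

- An even observable of the next site commutes with the range of [eps], hence
  is mapped by [eps] into the centre.  The algebra of one site is
  finite-dimensional ([fin_spanned_site]), so a minimal central projection is an
  eigenprojection of every self-adjoint central element
  ([minimal_projection_eigen]); by evenness the eigenvalue is the same on the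
  two projections of an orbit.  This is the Markov property ([eps_Qproj]). *)

(** * Norm and convergence *)

Section CStarNorm.
Variables (R : realType) (A : cstarType R).
Implicit Types (x y : A) (u v : nat -> A) (S G : set A).

Lemma star0 : star (0 : A) = 0.
Proof. by have := starD (0 : A) 0; rewrite addr0 -{1}[star 0]addr0 => /addrI. Qed.

Lemma starN x : star (- x) = - star x.
Proof. by apply/eqP; rewrite -addr_eq0 -starD addNr star0. Qed.

Lemma starB x y : star (x - y) = star x - star y.
Proof. by rewrite starD starN. Qed.

Lemma star1 : star (1 : A) = 1.
Proof. by rewrite -[LHS]mulr1 -[X in _ * X]starK -starM mulr1 starK. Qed.

Lemma star_sum I (r : seq I) (f : I -> A) :
  star (\sum_(i <- r) f i) = \sum_(i <- r) star (f i).
Proof. by apply: (big_morph star starD star0). Qed.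

Lemma cnorm0 : cnorm (0 : A) = 0.
Proof.
have := cnormZ 0 (0 : A); rewrite scale0r normr0 mul0r => /(congr1 (@complex.Re R)).
by [].
Qed.

Lemma cnormN x : cnorm (- x) = cnorm x.
Proof.
have := cnormZ (-1) x; rewrite scaleN1r normrN1 mul1r.
by move=> /(congr1 (@complex.Re R)).
Qed.

Lemma cnorm_ge0 x : 0 <= cnorm x.
Proof. have := cnormD x (- x); rewrite subrr cnorm0 cnormN; lra. Qed.

Lemma cdistC x y : cnorm (x - y) = cnorm (y - x).
Proof. by rewrite -cnormN opprB. Qed.

(** The C*-identity gives the inequality of the norms in one direction, and the
    involution exchanges its two sides. *)
Lemma cnorm_star x : cnorm (star x) = cnorm x.
Proof.
suff le (z : A) : cnorm z <= cnorm (star z).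
  by apply/eqP; rewrite eq_le le /= andbT -{2}(starK x) le.
have := cnormM (star z) z; rewrite cnorm_starM.
have := cnorm_ge0 z; rewrite le_eqVlt => /predU1P[<- _|z0]; first exact: cnorm_ge0.
by rewrite expr2 ler_pM2r.
Qed.

Lemma cnormZ_le (c : R[i]) x : cnorm (c *: x) = complex.Re `|c| * cnorm x.
Proof.
have /(congr1 (@complex.Re R)) := cnormZ c x.
by case: `|c| => a b /=; rewrite mulr0 subr0.
Qed.

Lemma norm_cvgP u x : norm_cvg u x <->
  forall e : R, 0 < e -> exists N, forall n, (N <= n)%N -> cnorm (u n - x) < e.
Proof.
split=> [ux e e0|ux].
  have [N _ NP] := cvgr0_norm_lt _ ux _ e0.
  exists N => n Nn; have := NP n Nn.
  by rewrite /= ger0_norm ?cnorm_ge0.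
apply/cvgr0Pnorm_lt => e e0; have [N NP] := ux e e0.
by exists N => // n Nn; rewrite /= ger0_norm ?cnorm_ge0//; exact: NP.
Qed.

Lemma norm_cvg_le u x (a : nat -> R) :
  (forall n, cnorm (u n - x) <= a n) -> a @ \oo --> (0 : R) -> norm_cvg u x.
Proof.
move=> ua a0; apply/norm_cvgP => e e0.
have [N _ NP] := cvgr0_norm_lt _ a0 _ e0.
exists N => n Nn; apply: le_lt_trans (ua n) _.
by apply: le_lt_trans (ler_norm _) _; exact: NP.
Qed.

Lemma norm_cvg_cst x : norm_cvg (fun=> x) x.
Proof. by apply/norm_cvgP => e e0; exists 0%N => n _; rewrite subrr cnorm0. Qed.

Lemma norm_cvgD u v x y :
  norm_cvg u x -> norm_cvg v y -> norm_cvg (fun n => u n + v n) (x + y).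
Proof.
move=> ux vy; apply: (@norm_cvg_le _ _ (fun n => cnorm (u n - x) + cnorm (v n - y))).
  by move=> n; rewrite opprD addrACA; exact: cnormD.
by rewrite -[0]addr0; apply: cvgD.
Qed.

Lemma norm_cvgZ (c : R[i]) u x : norm_cvg u x -> norm_cvg (fun n => c *: u n) (c *: x).
Proof.
move=> ux; apply: (@norm_cvg_le _ _ (fun n => complex.Re `|c| * cnorm (u n - x))).
  by move=> n; rewrite -scalerBr cnormZ_le.
by rewrite -(mulr0 (complex.Re `|c|)); apply: cvgMr.
Qed.

Lemma norm_cvgB u v x y :
  norm_cvg u x -> norm_cvg v y -> norm_cvg (fun n => u n - v n) (x - y).
Proof.
move=> ux vy; have := norm_cvgD ux (norm_cvgZ (-1) vy).
by rewrite scaleN1r; congr norm_cvg; apply/funext => n; rewrite scaleN1r.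
Qed.

Lemma norm_cvgM u v x y :
  norm_cvg u x -> norm_cvg v y -> norm_cvg (fun n => u n * v n) (x * y).
Proof.
move=> ux vy.
pose a n := cnorm (u n - x); pose b n := cnorm (v n - y).
apply: (@norm_cvg_le _ _ (fun n => a n * b n + cnorm x * b n + a n * cnorm y)).
  move=> n; have -> : u n * v n - x * y =
      (u n - x) * (v n - y) + x * (v n - y) + (u n - x) * y.
    by rewrite -mulrDl subrK mulrBr mulrBl addrA subrK.
  by apply: le_trans (cnormD _ _) _; apply: lerD; [apply: le_trans (cnormD _ _) _;
      apply: lerD|]; exact: cnormM.
have -> : 0 = 0 * 0 + cnorm x * 0 + 0 * cnorm y :> R by rewrite !mulr0 mul0r !addr0.
by apply: cvgD; [apply: cvgD|]; [exact: cvgM|apply: cvgMr|apply: cvgMl].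
Qed.
End CStarNorm.

(** * Subalgebras *)

Section Subalgebras.
Variables (R : realType) (A : cstarType R).
Implicit Types (x y : A) (S T G : set A).

(** Closedness in norm is left out: the algebras that are described by explicit
    linear combinations are only known to be dense at first. *)
Definition star_subalg T : Prop :=
  [/\ T 1, forall (c : R[i]) x y, T x -> T y -> T (c *: x + y),
      forall x y, T x -> T y -> T (x * y) & forall x, T x -> T (star x)].

Lemma cstar_star_subalg S : cstar_subalg S -> star_subalg S.
Proof. by case. Qed.

Section Closure.
Variables (T : set A) (T_alg : star_subalg T).

Lemma subalg1 : T 1. Proof. by case: T_alg. Qed.

Lemma subalgM x y : T x -> T y -> T (x * y).
Proof. by case: T_alg => _ _ h _; exact: h. Qed.

Lemma subalg_star x : T x -> T (star x).
Proof. by case: T_alg => _ _ _; exact. Qed.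

Lemma subalg0 : T 0.
Proof.
by case: T_alg => T1 h _ _; have := h (-1) 1 1 T1 T1; rewrite scaleN1r addNr.
Qed.

Lemma subalgD x y : T x -> T y -> T (x + y).
Proof. by case: T_alg => _ h _ _ Tx Ty; rewrite -[x]scale1r; apply: h. Qed.

Lemma subalgZ (c : R[i]) x : T x -> T (c *: x).
Proof.
by case: T_alg => _ h _ _ Tx; rewrite -[_ *: _]addr0; apply: h => //; exact: subalg0.
Qed.

Lemma subalgN x : T x -> T (- x).
Proof. by move=> Tx; rewrite -scaleN1r; exact: subalgZ. Qed.

Lemma subalgB x y : T x -> T y -> T (x - y).
Proof. by move=> Tx Ty; apply: subalgD => //; exact: subalgN. Qed.

Lemma subalg_sum I (r : seq I) (P : pred I) (f : I -> A) :
  (forall i, P i -> T (f i)) -> T (\sum_(i <- r | P i) f i).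
Proof. by move=> Tf; apply: (big_ind T); [exact: subalg0|exact: subalgD|]. Qed.

End Closure.

Definition closure_of T : set A := [set x | exists2 u, (forall n, T (u n)) & norm_cvg u x].

Lemma closure_ofP T x : closure_of T x <->
  forall e : R, 0 < e -> exists2 y, T y & cnorm (y - x) < e.
Proof.
split=> [[u Tu /norm_cvgP ux] e e0|h].
  by have [N NP] := ux e e0; exists (u N) => //; exact: NP.
have {}h n : exists y, T y /\ cnorm (y - x) < n.+1%:R^-1.
  by have [|y Ty yx] := h n.+1%:R^-1; [rewrite invr_gt0|exists y].
have [u uP] := choice h; exists u => [n|]; first by case: (uP n).
apply: (@norm_cvg_le _ _ _ _ (fun n => n.+1%:R^-1)) => [n|]; last exact: cvg_harmonic.
by case: (uP n) => _ /ltW.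
Qed.

Lemma sub_closure T : T `<=` closure_of T.
Proof. by move=> x Tx; exists (fun=> x) => //; exact: norm_cvg_cst. Qed.

(** The algebraic operations are continuous, so they extend from an algebra to
    its closure. *)
Lemma closure_subalg T : star_subalg T -> cstar_subalg (closure_of T).
Proof.
move=> aT; split.
- move=> u x cu /norm_cvgP ux; apply/closure_ofP => e e0.
  have [|N NP] := ux (e / 2); first by rewrite divr_gt0.
  have /closure_ofP /(_ (e / 2)) [|y Ty yu] := cu N; first by rewrite divr_gt0.
  exists y => //; have := NP N (leqnn N).
  have := cnormD (y - u N) (u N - x); rewrite addrA subrK; move: yu.
  set a := cnorm _; set b := cnorm _; set c := cnorm _; lra.
- by apply: sub_closure; exact: subalg1.
- move=> c x y [u Tu ux] [v Tv vy]; exists (fun n => c *: u n + v n).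
    by move=> n; apply: subalgD => //; exact: subalgZ.
  by apply: norm_cvgD => //; exact: norm_cvgZ.
- move=> x y [u Tu ux] [v Tv vy]; exists (fun n => u n * v n).
    by move=> n; exact: subalgM.
  exact: norm_cvgM.
- move=> x [u Tu ux]; exists (fun n => star (u n)).
    by move=> n; exact: subalg_star.
  apply: (@norm_cvg_le _ _ _ _ (fun n => cnorm (u n - x))) => // n.
  by rewrite -starB cnorm_star.
Qed.

Lemma cstar_gen_subalg G : cstar_subalg (cstar_gen G).
Proof.
split.
- by move=> u x Gu ux S aS GS; case: (aS) => h *; apply: (h u) => // n; exact: Gu.
- by move=> S [].
- by move=> c x y Gx Gy S aS GS; case: (aS) => _ _ h *; apply: h; [exact: Gx|exact: Gy].
- by move=> x y Gx Gy S aS GS; case: (aS) => _ _ _ h *; apply: h; [exact: Gx|exact: Gy].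
- by move=> x Gx S aS GS; case: (aS) => _ _ _ _ h; apply: h; exact: Gx.
Qed.

Lemma cstar_gen_alg G : star_subalg (cstar_gen G).
Proof. exact/cstar_star_subalg/cstar_gen_subalg. Qed.

Lemma sub_cstar_gen G : G `<=` cstar_gen G.
Proof. by move=> x Gx S _; exact. Qed.

Lemma cstar_gen_min G S : cstar_subalg S -> G `<=` S -> cstar_gen G `<=` S.
Proof. by move=> aS GS x; exact. Qed.

Lemma cstar_gen_sub G G' : G `<=` G' -> cstar_gen G `<=` cstar_gen G'.
Proof.
move=> GG'; apply: cstar_gen_min; first exact: cstar_gen_subalg.
by apply: subset_trans GG' _; exact: sub_cstar_gen.
Qed.

Lemma cstar_gen_closure G T : star_subalg T -> G `<=` T -> cstar_gen G `<=` closure_of T.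
Proof.
move=> aT GT; apply: cstar_gen_min; first exact: closure_subalg.
by apply: subset_trans GT _; exact: sub_closure.
Qed.

Lemma cnorm_cvg_unique (u : nat -> A) x y : norm_cvg u x -> norm_cvg u y -> x = y.
Proof.
move=> ux uy; apply/eqP; rewrite -subr_eq0; apply/eqP/cnorm0_eq0.
have := norm_cvgB ux uy; rewrite /norm_cvg.
under eq_fun do rewrite subrr sub0r cnormN.
by move=> h; apply: (cvg_unique _ _ h) => //; exact: cvg_cst.
Qed.

End Subalgebras.

(** * States *)

Section PositiveFunctionals.
Variables (R : realType) (A : cstarType R) (phi : A -> R[i]).
Hypothesis phi_state : is_state phi.
Implicit Types (x y b : A).

Lemma stateD x y : phi (x + y) = phi x + phi y.
Proof. by case: phi_state => l _ _ _; have := l 1 x y; rewrite scale1r mul1r. Qed.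

Lemma state0 : phi 0 = 0.
Proof. by have := stateD 0 0; rewrite addr0 -{1}[phi 0]addr0 => /addrI. Qed.

Lemma stateZ (c : R[i]) x : phi (c *: x) = c * phi x.
Proof. by case: phi_state => l _ _ _; have := l c x 0; rewrite state0 !addr0. Qed.

Lemma stateN x : phi (- x) = - phi x.
Proof. by rewrite -scaleN1r stateZ mulN1r. Qed.

Lemma stateB x y : phi (x - y) = phi x - phi y.
Proof. by rewrite stateD stateN. Qed.

Lemma state_sum I (r : seq I) (P : pred I) (f : I -> A) :
  phi (\sum_(i <- r | P i) f i) = \sum_(i <- r | P i) phi (f i).
Proof. by apply: (big_morph phi stateD state0). Qed.

Lemma state1 : phi 1 = 1. Proof. by case: phi_state. Qed.

Lemma state_ge0 x : 0 <= phi (star x * x). Proof. by case: phi_state. Qed.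

Lemma state_le x : `|phi x| <= (cnorm x)%:C. Proof. by case: phi_state. Qed.

(** Positivity at [c *: x + 1] makes [c phi x + conj c phi (star x)] real; the
    values 1 and 'i of [c] determine both numbers. *)
Lemma state_star x : phi (star x) = (phi x)^*.
Proof.
have real z : 0 <= z :> R[i] -> z^* = z by move=> z0; apply/CrealP; exact: ger0_real.
have h (c : R[i]) : (c * phi x + c^* * phi (star x))^* = c * phi x + c^* * phi (star x).
  have -> : c * phi x + c^* * phi (star x) =
      phi (star (c *: x + 1) * (c *: x + 1)) - phi (star (c *: x) * (c *: x)) - 1.
    rewrite starD star1 mulrDl !mulrDr !mulr1 mul1r !stateD state1 starZ !stateZ.
    by rewrite -starZ; ring.
  by rewrite !rmorphB /= rmorph1 !real ?state_ge0.
have h1 := h 1; have hi := h 'i.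
move: h1; rewrite rmorph1 !mul1r rmorphD /= => h1.
move: hi; rewrite rmorphD !rmorphM /= conjCi rmorphN /= conjCi opprK => hi.
have i0 : 'i != 0 :> R[i] by exact: neq0Ci.
have {}hi : (phi (star x))^* - (phi x)^* = phi x - phi (star x).
  by apply: (mulfI i0); rewrite !mulrBr addrC -mulNr hi mulNr.
have : 2 * (phi (star x))^* = 2 * phi x.
  have -> : 2 * (phi (star x))^* = ((phi x)^* + (phi (star x))^*) + ((phi (star x))^* -
      (phi x)^*) by ring.
  by rewrite h1 hi; ring.
by move=> /mulfI <-; rewrite ?conjCK ?pnatr_eq0.
Qed.

Lemma state_real x : star x = x -> phi x \is Num.real.
Proof. by move=> xx; apply/CrealP; rewrite -state_star xx. Qed.

(** Positivity at [x - c *: y], for the best scalar [c]. *)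
Theorem Cauchy_Schwarz x y :
  `|phi (star x * y)| ^+ 2 <= phi (star x * x) * phi (star y * y).
Proof.
set a := phi (star x * x); set d := phi (star y * y); set b := phi _.
have bC : phi (star y * x) = b^* by rewrite -state_star starM starK.
have a0 : 0 <= a := state_ge0 x.
have d0 : 0 <= d := state_ge0 y.
have key (c : R[i]) : 0 <= a - c * b - c^* * b^* + c * c^* * d.
  have h := state_ge0 (x - c *: y).
  rewrite starB starZ mulrBl !mulrBr -!scalerAr -!scalerAl !stateB !stateZ bC in h.
  move: h; rewrite -/a -/b -/d.
  by congr (_ <= _); ring.
have bb : b * b^* = `|b| ^+ 2 by rewrite normCK.
move: d0; rewrite le_eqVlt => /predU1P[d0|d0].
  have [->|bn0] := eqVneq b 0; first by rewrite normr0 expr0n /= -d0 mulr0.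
  have b2 : 0 < `|b| ^+ 2 by rewrite exprn_gt0 ?normr_gt0.
  (* The expression is now linear in c; this multiple makes it equal to -1. *)
  pose t := (a + 1) / (2 * `|b| ^+ 2).
  have tr : t^* = t by apply/CrealP; apply: ger0_real; apply: divr_ge0;
      [exact: addr_ge0|apply: mulr_ge0 => //; exact: ltW].
  have := key (t * b^*); rewrite -d0 mulr0 addr0 rmorphM /= conjCK tr.
  have -> : a - t * b^* * b - t * b * b^* = -1.
    have -> : a - t * b^* * b - t * b * b^* = a - 2 * t * (b * b^*) by ring.
    have e (m : R[i]) : m != 0 -> a - 2 * ((a + 1) / (2 * m)) * m = -1 by move=> m0; field.
    by rewrite bb /t e // gt_eqF.
  by rewrite oppr_ge0 ler10.
have dr : d^* = d by apply/CrealP; apply: ger0_real; exact: ltW.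
(* The minimum of the quadratic expression in c. *)
have := key (b^* / d); rewrite rmorphM /= conjCK fmorphV /= dr.
have -> : a - b^* / d * b - b / d * b^* + b^* / d * (b / d) * d = a - (b * b^*) / d.
  by field; rewrite gt_eqF.
by rewrite bb subr_ge0 ler_pdivrMr.
Qed.

(** By the Cauchy-Schwarz inequality.  This replaces cancellation: it gives access
    to the zeros of a state without square roots of positive elements. *)
Lemma state_nullr x y : phi (star x * x) = 0 -> phi (star y * x) = 0.
Proof.
move=> x0; have := Cauchy_Schwarz y x; rewrite x0 mulr0.
by rewrite -normrX normr_le0 expf_eq0 /= => /eqP.
Qed.

Lemma state_nulll x y : phi (star x * x) = 0 -> phi (star x * y) = 0.
Proof.
move=> x0; have := Cauchy_Schwarz x y; rewrite x0 mul0r.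
by rewrite -normrX normr_le0 expf_eq0 /= => /eqP.
Qed.

Lemma state_dist x y : `|phi x - phi y| <= (cnorm (x - y))%:C.
Proof. by rewrite -stateB; exact: state_le. Qed.

Lemma state_cvg_unique (u : nat -> A) x (c : R[i]) :
  norm_cvg u x -> (forall n, phi (u n) = c) -> phi x = c.
Proof.
move=> /norm_cvgP ux uc; apply/eqP; rewrite -subr_eq0 -normr_eq0.
apply/eqP/le_anti; rewrite normr_ge0 andbT.
have lt (e : R) : 0 < e -> `|phi x - c| <= e%:C.
  move=> e0; have [N /(_ N (leqnn N)) h] := ux e e0.
  rewrite -(uc N); apply: le_trans (state_dist _ _) _.
  by rewrite lecR cdistC ltW.
have : `|phi x - c| = (complex.Re `|phi x - c|)%:C.
  by apply/esym; apply: RRe_real; exact: normr_real.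
move=> eqn; rewrite eqn lecR; apply/ler_addgt0Pr => e e0.
by rewrite add0r -lecR -eqn lt.
Qed.

End PositiveFunctionals.

(** A strict inequality [m < a] would make the quotient of the powers grow without
    bound. *)
Lemma le_of_pow2_le (R : realType) (a m c K : R) : 0 <= a -> 0 <= m -> 0 < c ->
  0 <= K -> (forall n, a ^+ (2 ^ n) * c <= m ^+ (2 ^ n) * K) -> a <= m.
Proof.
move=> a0 m0 c0 K0 h; rewrite leNgt; apply/negP => ma.
have {}a0 : 0 < a by exact: le_lt_trans ma.
have ma0 : 0 <= m / a by apply: divr_ge0 => //; exact: ltW.
have z1 : `|m / a| < 1 by rewrite ger0_norm// ltr_pdivrMr ?mul1r.
have e0 : 0 < c / (K + 1) by rewrite divr_gt0 ?ltr_wpDl.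
have [N _ /(_ (2 ^ N)%N (ltnW (ltn_expl _ _)))] := cvgr0_norm_lt _ (cvg_expr z1) _ e0.
move=> /(_ isT); rewrite /= ger0_norm ?exprn_ge0//.
have := h N; rewrite expr_div_n => hN.
rewrite ltr_pdivrMr ?exprn_gt0// mulrAC ltr_pdivlMr ?ltr_wpDl// => hN'.
have : m ^+ (2 ^ N) * K <= m ^+ (2 ^ N) * (K + 1).
  by rewrite ler_wpM2l ?exprn_ge0 ?lerDl.
by move: hN hN'; rewrite [a ^+ _ * _]mulrC; lra.
Qed.

Section ConjugationBound.
Variables (R : realType) (A : cstarType R) (phi : A -> R[i]).
Hypothesis phi_state : is_state phi.
Implicit Types (x b : A).

Lemma cnorm_exp x n : cnorm (x ^+ n.+1) <= cnorm x ^+ n.+1.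
Proof.
elim: n => [|n IHn]; first by rewrite !expr1.
rewrite exprS [leRHS]exprS; apply: le_trans (cnormM _ _) _.
by rewrite ler_wpM2l ?cnorm_ge0.
Qed.

(** The functional [x |-> phi (star b * x * b)] is positive, of norm [phi (star b * b)].
    Functional calculus is avoided: for self-adjoint [h] the Cauchy-Schwarz
    inequality is iterated, which replaces [h] by [h ^+ (2 ^ n)], and the root of
    order [2 ^ n] of the resulting estimate is taken. *)
Lemma state_conj_le b x :
  `|phi (star b * x * b)| <= (cnorm x)%:C * phi (star b * b).
Proof.
have c0 : 0 <= phi (star b * b) := state_ge0 phi_state b.
have selfadjoint h : star h = h ->
    `|phi (star b * h * b)| <= (cnorm h)%:C * phi (star b * b).
  move=> hh; have [cz|cn0] := eqVneq (phi (star b * b)) 0.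
    by rewrite -mulrA (state_nulll phi_state) // normr0 cz mulr0.
  pose f n := `|phi (star b * h ^+ (2 ^ n) * b)|.
  have cp : 0 < phi (star b * b) by rewrite lt_def cn0.
  have hp n : star (h ^+ n) = h ^+ n.
    by elim: n => [|n IHn]; [rewrite expr0 star1|rewrite exprSr starM IHn hh -exprS exprSr].
  have fS n : f n ^+ 2 <= phi (star b * b) * f n.+1.
    have := Cauchy_Schwarz phi_state b (h ^+ (2 ^ n) * b).
    rewrite mulrA -/(f n) => /le_trans; apply; rewrite ler_wpM2l//.
    have e : star b * h ^+ (2 ^ n.+1) * b = star (h ^+ (2 ^ n) * b) * (h ^+ (2 ^ n) * b).
      by rewrite starM hp expnS mul2n -addnn exprD !mulrA.
    by rewrite /f e ger0_norm//; exact: state_ge0.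
  have fN n : f 0%N ^+ (2 ^ n) * phi (star b * b) <= phi (star b * b) ^+ (2 ^ n) * f n.
    elim: n => [|n IHn]; first by rewrite expn0 !expr1 mulrC.
    rewrite -(ler_pM2r cp) expnS mul2n -addnn !exprD.
    have -> : f 0%N ^+ (2 ^ n) * f 0%N ^+ (2 ^ n) * phi (star b * b) * phi (star b * b) =
        (f 0%N ^+ (2 ^ n) * phi (star b * b)) ^+ 2 by ring.
    apply: le_trans (_ : (phi (star b * b) ^+ (2 ^ n) * f n) ^+ 2 <= _).
      rewrite ler_pXn2r// ?nnegrE ?mulr_ge0 ?exprn_ge0 ?normr_ge0//.
    have -> : (phi (star b * b) ^+ (2 ^ n) * f n) ^+ 2 = phi (star b * b) ^+ (2 ^ n) * phi
        (star b * b) ^+ (2 ^ n) * f n ^+ 2 by ring.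
    by rewrite -[leRHS]mulrA ler_wpM2l ?mulr_ge0 ?exprn_ge0// mulrC.
  have toR (z : R[i]) : 0 <= z -> z = (complex.Re z)%:C.
    by move=> z0; apply/esym/RRe_real; exact: ger0_real.
  have fR n : f n = (complex.Re (f n))%:C by apply: toR; exact: normr_ge0.
  have cR := toR _ c0.
  rewrite -[X in _ * X * _]expr1 -(expn0 2) -/(f 0%N) fR cR -rmorphM lecR mulrC.
  have cp' : 0 < complex.Re (phi (star b * b)) by rewrite -ltcR -cR.
  have f0 : 0 <= complex.Re (f 0%N) by rewrite -lecR -fR normr_ge0.
  apply: (@le_of_pow2_le _ _ _ _ (cnorm b ^+ 2) f0 _ cp');
      rewrite ?exprn_ge0 ?mulr_ge0 ?cnorm_ge0 ?ltW// => n.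
  have := fN n; rewrite (fR 0%N) (fR n) cR -!rmorphXn -!rmorphM lecR => /le_trans; apply.
  rewrite exprMn -mulrA ler_wpM2l ?exprn_ge0//; first exact: ltW.
  rewrite -lecR -fR; apply: le_trans (state_le phi_state _) _; rewrite lecR.
  apply: le_trans (cnormM _ _) _; rewrite expr2 mulrA.
  rewrite ler_wpM2r ?cnorm_ge0//.
  apply: le_trans (cnormM _ _) _; rewrite cnorm_star mulrC ler_wpM2r ?cnorm_ge0//.
  by rewrite -(prednK (expn_gt0 2 n : 0 < 2 ^ n)%N) cnorm_exp.
have := Cauchy_Schwarz phi_state b (x * b); rewrite mulrA => cs.
rewrite -(@ler_pXn2r _ 2)// ?nnegrE ?mulr_ge0 ?normr_ge0 ?lecR ?cnorm_ge0//.
apply: le_trans cs _; rewrite exprMn [X in _ <= _ * X]expr2 mulrCA ler_wpM2l//.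
have e : star (x * b) * (x * b) = star b * (star x * x) * b by rewrite starM !mulrA.
have s : star (star x * x) = star x * x by rewrite starM starK.
have := selfadjoint _ s; rewrite -e ger0_norm ?state_ge0//.
by rewrite cnorm_starM rmorphXn.
Qed.

End ConjugationBound.

(** * Ergodic averages of completely positive maps *)

Section ErgodicAverage.
Variables (R : realType) (A : cstarType R) (phi : A -> R[i]).
Hypothesis phi_state : is_state phi.
Variables (D B L : set A) (f : A -> A).
Hypothesis L_alg : cstar_subalg L.
Hypothesis LD : L `<=` D.
Hypothesis f_lin : linear_on L f.
Hypothesis fL : forall x, L x -> L (f x).
Hypothesis f_cp : cp_on D B f.
Hypothesis f1 : f 1 = 1.
Hypothesis f_phi : forall x, L x -> phi (f x) = phi x.
Hypothesis phi_faithful : faithful_on L phi.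
Implicit Types (x y b : A).

Let aL : star_subalg L := cstar_star_subalg L_alg.

(** Complete positivity, applied to the matrix with the single non-zero row [s]. *)
Lemma cp_gram n (s : 'I_n -> A) : (forall i, L (s i)) ->
  exists Y : 'M[A]_n, forall i j,
    f (star (s i) * s j) = \sum_k star (Y k i) * Y k j.
Proof.
case: n s => [|n] s Ls; first by exists 0 => -[].
have [|Y _ YE] := f_cp (X := \matrix_(i, j) if i == 0 then s j else 0).
  by move=> i j; rewrite mxE; apply: LD; case: ifP => // _; exact: subalg0.
exists Y => i j; move/matrixP: YE => /(_ i j); rewrite !mxE.
under eq_bigr do rewrite !mxE.
under [X in _ = X -> _]eq_bigr do rewrite !mxE.
move=> <-; congr f; rewrite big_ord_recl /= big1 ?addr0// => k _.
by rewrite star0 mul0r.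
Qed.

Lemma cp_star x : L x -> f (star x) = star (f x).
Proof.
move=> Lx; have [|Y YE] := cp_gram (s := fun i : 'I_2 => if i == 0 then 1 else x).
  by move=> i; case: ifP => // _; exact: subalg1.
have := YE 1 0; have := YE 0 1; rewrite /= star1 mul1r mulr1 => -> ->.
by rewrite star_sum; apply: eq_bigr => k _; rewrite starM starK.
Qed.

(** The defect of multiplicativity of [f] is a Gram matrix.  The [t i] are the
    entries of the column belonging to [x], minus the part [u * f x] which the
    column [u] belonging to 1 accounts for. *)
Lemma cp_defect x y : L x -> L y -> exists n (t w : 'I_n -> A),
  f (star x * x) - star (f x) * f x = \sum_i star (t i) * t i /\
  f (star x * y) - star (f x) * f y = \sum_i star (t i) * w i.
Proof.
move=> Lx Ly.
pose s (i : 'I_3) := if i == 0 then 1 else if i == 1 then x else y.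
have [|Y YE] := cp_gram (s := s).
  by move=> i; rewrite /s; case: ifP => _; [exact: subalg1|case: ifP].
have e00 := YE 0 0; have e01 := YE 0 1; have e11 := YE 1 1.
have e02 := YE 0 (inord 2); have e12 := YE 1 (inord 2); have e10 := YE 1 0.
have s2 : s (inord 2) = y by rewrite /s -!val_eqE /= inordK.
rewrite s2 /s /= ?star1 ?mul1r ?mulr1 ?f1 in e00 e01 e02 e10 e11 e12.
exists 3, (fun k => Y k 1 - Y k 0 * f x), (fun k => Y k (inord 2)).
have fs : star (f x) = \sum_k star (Y k 1) * Y k 0 by rewrite -cp_star.
split.
  have ex k : star (Y k 1 - Y k 0 * f x) * (Y k 1 - Y k 0 * f x) =
      star (Y k 1) * Y k 1 - star (Y k 1) * Y k 0 * f x -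
      (star (f x) * (star (Y k 0) * Y k 1) - star (f x) * (star (Y k 0) * Y k 0) * f x).
    by rewrite starB starM mulrBl !mulrBr !mulrA.
  under eq_bigr do rewrite ex.
  rewrite !sumrB -!mulr_suml -!mulr_sumr -e11 -e01 -e00 -fs mulr1 subrr subr0.
  by [].
rewrite e12; under [RHS]eq_bigr do rewrite starB starM mulrBl -mulrA.
by rewrite sumrB -mulr_sumr -e02.
Qed.

(** The defect of [b] is positive and of state 0, as [f] preserves [phi].  Its terms
    [star (t i) * t i] need not lie in [L], where alone [phi] is faithful.  The
    defect itself does, and the Cauchy-Schwarz inequality shows that it is a null
    vector, hence 0.  The same argument then kills the mixed defect of [b] and [y]. *)
Lemma fixed_mull b y : L b -> L y -> f b = b -> f (star b * y) = star b * f y.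
Proof.
move=> Lb Ly fb; have [n [t [w [dt dw]]]] := cp_defect Lb Ly.
rewrite fb in dt dw; set p := f (star b * b) - star b * b in dt.
have Lbb : L (star b * b) by apply: subalgM => //; exact: subalg_star.
(* p is a sum of star t * t of state 0, so it is a null vector in L. *)
have p0 : p = 0.
  have phip : phi p = 0 by rewrite stateB// f_phi// subrr.
  have t0 k : phi (star (t k) * t k) = 0.
    apply/eqP; have /eqP := phip; rewrite dt state_sum//.
    rewrite psumr_eq0; last by move=> i _; exact: state_ge0.
    by move=> /allP/(_ k); rewrite mem_index_enum; exact.
  have Lp : L p by apply: subalgB => //; exact: fL.
  apply: phi_faithful => //.
  rewrite {2}dt mulr_sumr state_sum// big1// => i _.
  rewrite mulrA -[star p * _]starK starM starK; apply: state_nullr => //.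
pose r := f (star b * y) - star b * f y.
suff : r = 0 by move=> /eqP; rewrite subr_eq0 => /eqP.
have Lr : L r.
  by apply: subalgB => //; [apply: fL|]; apply: subalgM => //;
      [exact: subalg_star..|exact: fL].
apply: phi_faithful => //; rewrite {2}/r dw mulr_sumr state_sum//.
apply: big1 => i _.
have -> : star r * (star (t i) * w i) = star (t i * r) * w i by rewrite starM mulrA.
(* t i * r is a null vector too: the squares of these vectors add up to
   star r * p * r, which vanishes. *)
apply: state_nulll => //.
have : phi (star r * p * r) == 0 by rewrite p0 mulr0 mul0r state0.
rewrite dt mulr_sumr mulr_suml state_sum// psumr_eq0; last first.
  by move=> k _; rewrite mulrA -starM -mulrA; exact: state_ge0.
by move=> /allP/(_ i); rewrite mem_index_enum mulrA -starM -mulrA => /(_ isT)/eqP.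
Qed.

Let sqn x : R := complex.Re (phi (star x * x)).

Lemma sqnE x : phi (star x * x) = (sqn x)%:C.
Proof. by apply/esym; apply: RRe_real; apply: ger0_real; exact: state_ge0. Qed.

Lemma sqn_ge0 x : 0 <= sqn x.
Proof. by rewrite -lecR -sqnE; exact: state_ge0. Qed.

Lemma sqnD x y : sqn (x + y) <= 2 * (sqn x + sqn y).
Proof.
rewrite -subr_ge0; apply: le_trans (sqn_ge0 (x - y)) _.
rewrite le_eqVlt; apply/orP; left; apply/eqP.
apply: complexI; rewrite rmorphB rmorphM !rmorphD rmorph1 /= -!sqnE.
by rewrite starB starD !(mulrDl, mulrDr, mulNr, mulrN) !(stateD, stateN)//; ring.
Qed.

Lemma sqnN x : sqn (- x) = sqn x.
Proof. by rewrite /sqn starN mulrNN. Qed.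

Lemma sqnZ (c : R) x : sqn (c%:C *: x) = c ^+ 2 * sqn x.
Proof.
apply: complexI; rewrite rmorphM rmorphXn /= -!sqnE starZ -scalerAr -scalerAl !stateZ//.
have -> : (c%:C)^* = c%:C :> R[i] by exact: conjc_real.
by rewrite mulrA expr2.
Qed.

(** The Schwarz inequality for [f], integrated against the invariant state. *)
Lemma sqn_contraction x : L x -> sqn (f x) <= sqn x.
Proof.
move=> Lx; have [n [t [_ [dt _]]]] := cp_defect Lx Lx.
have Lxx : L (star x * x) by apply: subalgM => //; exact: subalg_star.
rewrite -lecR -!sqnE -subr_ge0 -(f_phi Lxx) -stateB// dt state_sum//.
by apply: sumr_ge0 => i _; exact: state_ge0.
Qed.

Lemma sqn_le x : sqn x <= cnorm x ^+ 2.
Proof.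
rewrite -lecR -sqnE -cnorm_starM; apply: le_trans (state_le phi_state _).
by rewrite ger0_norm//; exact: state_ge0.
Qed.

Definition ergodic_mean k x : A := (k.+1%:R : R[i])^-1 *: \sum_(h < k.+1) iter h f x.

Lemma iterL h x : L x -> L (iter h f x).
Proof. by move=> Lx; elim: h => //= h; exact: fL. Qed.

Lemma ergodic_meanL k x : L x -> L (ergodic_mean k x).
Proof.
by move=> Lx; apply: subalgZ => //; apply: subalg_sum => // i _; exact: iterL.
Qed.

Lemma f_lin0 : f 0 = 0.
Proof.
have L0 := subalg0 aL; have := f_lin 1 L0 L0.
by rewrite !scale1r addr0 -{1}[f 0]addr0 => /addrI.
Qed.

Lemma f_linZ (c : R[i]) x : L x -> f (c *: x) = c *: f x.
Proof. by move=> Lx; have := f_lin c Lx (subalg0 aL); rewrite f_lin0 !addr0. Qed.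

Lemma f_linD x y : L x -> L y -> f (x + y) = f x + f y.
Proof. by move=> Lx Ly; have := f_lin 1 Lx Ly; rewrite !scale1r. Qed.

Lemma f_linB x y : L x -> L y -> f (x - y) = f x - f y.
Proof.
move=> Lx Ly; rewrite f_linD//; last exact: subalgN.
by rewrite -scaleN1r f_linZ// scaleN1r.
Qed.

(** The sum telescopes. *)
Lemma f_ergodic_mean k x : L x ->
  f (ergodic_mean k x) - ergodic_mean k x = (k.+1%:R : R[i])^-1 *: (iter k.+1 f x - x).
Proof.
move=> Lx; rewrite /ergodic_mean f_linZ; last by apply: subalg_sum => // i _; exact: iterL.
rewrite -scalerBr; congr (_ *: _).
elim: k => [|k IHk]; first by rewrite !big_ord1.
rewrite big_ord_recr /= (f_linD _ (iterL k.+1 Lx)); last by apply: subalg_sum => // i _;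
    exact: iterL.
rewrite opprD addrACA IHk /= addrC addrA subrK//.
Qed.

Section Limit.
Variable eps : A -> A.
Hypothesis eps_lim : forall x, L x -> norm_cvg (ergodic_mean^~ x) (eps x).

Lemma epsL x : L x -> L (eps x).
Proof.
case: L_alg => closedL _ _ _ _ Lx.
by apply: (closedL (ergodic_mean^~ x)) (eps_lim Lx) => k; exact: ergodic_meanL.
Qed.

(** Nothing is known about the continuity of [f] for the norm, so the argument takes
    place in the Hilbert norm of [phi], for which [f] is a contraction and which is
    dominated by the norm. *)
Lemma f_eps x : L x -> f (eps x) = eps x.
Proof.
move=> Lx; have Le := epsL Lx; apply/eqP; rewrite -subr_eq0; apply/eqP.
apply: phi_faithful; first by apply: subalgB => //; exact: fL.
rewrite sqnE; set z := f (eps x) - eps x; congr (_%:C).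
pose b k := 8 * (cnorm (ergodic_mean k x - eps x) ^+ 2 + (k.+1%:R^-1 * cnorm x) ^+ 2).
(* Split z into the defects of the limit minus the mean and of the mean. *)
have zb k : sqn z <= b k.
  have Lm := ergodic_meanL k Lx; rewrite /b; set m := ergodic_mean k x in Lm *.
  have -> : z = (f (eps x - m) - (eps x - m)) + (f m - m).
    by rewrite f_linB// [RHS]addrAC subrKA opprB subrKA.
  have h1 : sqn (f (eps x - m) - (eps x - m)) <= 4 * cnorm (m - eps x) ^+ 2.
    apply: le_trans (sqnD _ _) _; rewrite sqnN.
    have Ld : L (eps x - m) by exact: subalgB.
    have := sqn_le (eps x - m); have := sqn_contraction Ld; rewrite cdistC.
    set a := sqn _; set c := sqn _; set d := cnorm _; lra.
  have h2 : sqn (f m - m) <= 4 * (k.+1%:R^-1 * cnorm x) ^+ 2.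
    have kC : (k.+1%:R : R[i])^-1 = (k.+1%:R^-1 : R)%:C by rewrite fmorphV rmorph_nat.
    rewrite f_ergodic_mean// kC sqnZ exprMn mulrCA.
    rewrite ler_wpM2l ?exprn_ge0 ?invr_ge0//.
    apply: le_trans (sqnD _ _) _; rewrite sqnN.
    have : sqn (iter k.+1 f x) <= sqn x.
      elim: k.+1 => //= h; apply: le_trans; apply: sqn_contraction; exact: iterL.
    have := sqn_le x; set a := sqn _; set c := sqn _; set d := cnorm _; lra.
  apply: le_trans (sqnD _ _) _.
  move: h1 h2; set a := sqn _; set c := sqn _; set d := _ ^+ 2; set e := _ ^+ 2; lra.
apply/le_anti; rewrite sqn_ge0 andbT.
have b0 : b @ \oo --> (0 : R).
  have h1 : (fun k => cnorm (ergodic_mean k x - eps x)) @ \oo --> (0 : R) := eps_lim Lx.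
  have h2 : (fun k => k.+1%:R^-1 * cnorm x) @ \oo --> (0 : R).
    by rewrite -(mul0r (cnorm x)); apply: cvgMl; exact: cvg_harmonic.
  have -> : 0 = 8 * (0 * 0 + 0 * 0) :> R by rewrite !mul0r addr0 mulr0.
  by apply: cvgMr; apply: cvgD; exact: cvgM.
by apply: (cvgr_to_ge b0); apply: nearW => k; exact: zb.
Qed.

Lemma iter_fixed h b : f b = b -> iter h f b = b.
Proof. by move=> fb; elim: h => //= h ->. Qed.

Lemma ergodic_mean_eq k x y : (forall h, iter h f x = y) -> ergodic_mean k x = y.
Proof.
move=> e; rewrite /ergodic_mean (eq_bigr (fun=> y))//.
rewrite sumr_const card_ord -scalerMnr scalerMnl -mulr_natr mulVf ?scale1r//.
Qed.

Lemma eps_fixed b : L b -> f b = b -> eps b = b.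
Proof.
move=> Lb fb; apply: (cnorm_cvg_unique (eps_lim Lb)).
have -> : ergodic_mean^~ b = fun=> b; last exact: norm_cvg_cst.
by apply/funext => k; apply: ergodic_mean_eq => h; exact: iter_fixed.
Qed.

Lemma eps_linear : linear_on L eps.
Proof.
move=> c x y Lx Ly; have Lxy : L (c *: x + y) by apply: subalgD => //; exact: subalgZ.
apply: (cnorm_cvg_unique (eps_lim Lxy)).
have := norm_cvgD (norm_cvgZ c (eps_lim Lx)) (eps_lim Ly).
congr norm_cvg; apply/funext => k; rewrite /ergodic_mean scalerA mulrC -scalerA -scalerDr.
congr (_ *: _); rewrite scaler_sumr -big_split; apply: eq_bigr => /= i _.
elim: (val i) => //= h <-; rewrite f_linD ?f_linZ//; try exact: iterL.
by apply: subalgZ => //; exact: iterL.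
Qed.

Lemma eps_star x : L x -> eps (star x) = star (eps x).
Proof.
move=> Lx; have Lsx : L (star x) by exact: subalg_star.
apply: (cnorm_cvg_unique (eps_lim Lsx)).
apply: (@norm_cvg_le _ _ _ _ (fun k => cnorm (ergodic_mean k x - eps x)));
    last exact: eps_lim.
move=> k; rewrite -cnorm_star starB starK le_eqVlt; apply/orP; left.
apply/eqP; congr (cnorm (_ - _)); rewrite /ergodic_mean starZ star_sum.
rewrite fmorphV rmorph_nat; congr (_ *: _); apply: eq_bigr => /= i _.
elim: (val i) => /= [|h IH]; first by rewrite starK.
rewrite -IH -cp_star ?starK// -?IH; last exact: iterL.
Qed.

(** Each iterate of [f] commutes with the multiplication by a fixed point. *)
Lemma eps_mull b y : L b -> L y -> f b = b -> eps (b * y) = b * eps y.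
Proof.
move=> Lb Ly fb; have Lbs : L (star b) by exact: subalg_star.
have fbs : f (star b) = star b by rewrite cp_star// fb.
have Lby : L (b * y) by exact: subalgM.
apply: (cnorm_cvg_unique (eps_lim Lby)).
have := norm_cvgM (norm_cvg_cst b) (eps_lim Ly).
congr norm_cvg; apply/funext => k; rewrite /ergodic_mean -scalerAr mulr_sumr.
congr (_ *: _); apply: eq_bigr => i _; elim: (val i) => //= h <-.
by rewrite -{2}[b]starK fixed_mull ?starK//; exact: iterL.
Qed.

Lemma eps_mulr b y : L b -> L y -> f b = b -> eps (y * b) = eps y * b.
Proof.
move=> Lb Ly fb; have Lbs : L (star b) by exact: subalg_star.
have fbs : f (star b) = star b by rewrite cp_star// fb.
have Lys : L (star y) by exact: subalg_star.
rewrite -[y * b]starK starM eps_star; last exact: subalgM.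
by rewrite eps_mull// starM starK eps_star// starK.
Qed.

Lemma eps_invariant x y (c : R[i]) : L y ->
  (forall h, phi (x * iter h f y) = c) -> phi (x * eps y) = c.
Proof.
move=> Ly xc; apply: (state_cvg_unique phi_state (norm_cvgM (norm_cvg_cst x) (eps_lim Ly)))
    => k.
rewrite /ergodic_mean -scalerAr mulr_sumr stateZ// state_sum// (eq_bigr (fun=> c)) => [|i
    _]; last exact: xc.
by rewrite sumr_const card_ord -[c *+ _]mulr_natl mulKf// pnatr_eq0.
Qed.

Lemma eps_commute (g : A -> A) :
  linear g -> (forall x, cnorm (g x) = cnorm x) -> (forall x, L x -> L (g x)) ->
  (forall x, L x -> f (g x) = g (f x)) -> forall x, L x -> eps (g x) = g (eps x).
Proof.
move=> gl gn gL fg x Lx; apply: (cnorm_cvg_unique (eps_lim (gL _ Lx))).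
have gD u v : g (u + v) = g u + g v by have := gl 1 u v; rewrite !scale1r.
have g0 : g 0 = 0 by have := gD 0 0; rewrite addr0 -{1}[g 0]addr0 => /addrI.
have gN u : g (- u) = - g u by apply/eqP; rewrite -addr_eq0 -gD addNr g0.
have gZ (c : R[i]) u : g (c *: u) = c *: g u by have := gl c u 0; rewrite g0 !addr0.
apply: (@norm_cvg_le _ _ _ _ (fun k => cnorm (ergodic_mean k x - eps x)));
    last exact: eps_lim.
move=> k; rewrite -(gn (ergodic_mean k x - eps x)) gD gN /ergodic_mean gZ.
rewrite (big_morph g gD g0) le_eqVlt; apply/orP; left; apply/eqP.
congr (cnorm (_ *: _ - _)); apply: eq_bigr => i _.
by elim: (val i) => //= h ->; rewrite fg//; exact: iterL.
Qed.

End Limit.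
End ErgodicAverage.

(** * Parity and graded commutation *)

Section LinearSpan.
Variables (R : realType) (A : cstarType R).
Implicit Types (x y : A) (V G : set A).

Definition lin_subspace V : Prop :=
  V 0 /\ forall (c : R[i]) x y, V x -> V y -> V (c *: x + y).

(** Impredicative, so that an inclusion in a subspace is proved by checking it on the
    generators. *)
Definition lin_span G : set A := [set x | forall V, lin_subspace V -> G `<=` V -> V x].

Lemma lin_span_lin G : lin_subspace (lin_span G).
Proof.
split=> [V []//|c x y Gx Gy V sV GV].
by case: (sV) => _; apply; [exact: Gx|exact: Gy].
Qed.

Lemma sub_lin_span G : G `<=` lin_span G.
Proof. by move=> x Gx V _; exact. Qed.

Lemma lin_span_alg G : G 1 -> (forall x y, G x -> G y -> lin_span G (x * y)) ->
  (forall x, G x -> lin_span G (star x)) -> star_subalg (lin_span G).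
Proof.
move=> G1 GM Gs; have [s0 sD] := lin_span_lin G.
split => //; first exact: sub_lin_span.
- move=> x y Gx Gy; suff : lin_span G `<=` [set x | forall y, lin_span G y ->
    lin_span G (x * y)].
    by move=> /(_ x Gx); exact.
  move=> {}x {}Gx; apply: Gx => [|{}x Gx {Gy}y Gy].
    split=> [z _|c u v IH IH' z Gz]; first by rewrite mul0r.
    by rewrite mulrDl -scalerAl; apply: sD; [exact: IH|exact: IH'].
  apply: (Gy [set y | lin_span G (x * y)]) => [|{Gy}y Gy]; last exact: GM.
  split=> [|c u v IH IH'] /=; first by rewrite mulr0.
  by rewrite mulrDr -scalerAr; exact: sD.
- move=> x Gx; apply: (Gx [set x | lin_span G (star x)]) => [|{Gx}x Gx]; last exact: Gs.
  split=> [|c u v IH IH'] /=; first by rewrite star0.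
  by rewrite starD starZ; exact: sD.
Qed.

End LinearSpan.

Section Fermions.
Variables (R : realType) (A : cstarType R) (F : fermion A).
Local Notation I := (sites F).
Local Notation Theta := (parity F).
Implicit Types (x y z : A) (S T : set int).

Lemma parityD x y : Theta (x + y) = Theta x + Theta y.
Proof. by have := parity_linear F 1 x y; rewrite !scale1r. Qed.

Lemma parity0 : Theta 0 = 0.
Proof. by apply: (@addrI _ (Theta 0)); rewrite -parityD !addr0. Qed.

Lemma parityN x : Theta (- x) = - Theta x.
Proof. by apply/eqP; rewrite -addr_eq0 -parityD addNr parity0. Qed.

Lemma parityB x y : Theta (x - y) = Theta x - Theta y.
Proof. by rewrite parityD parityN. Qed.

Lemma parityZ (c : R[i]) x : Theta (c *: x) = c *: Theta x.
Proof. by have := parity_linear F c x 0; rewrite parity0 !addr0. Qed.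

Lemma parity1 : Theta 1 = 1.
Proof.
have [g _ gK] := parity_bij F.
by rewrite -[LHS]mulr1 -[X in _ * X](gK 1) -parity_mul mul1r gK.
Qed.

Lemma parity_cvg (u : nat -> A) x : norm_cvg u x -> norm_cvg (Theta \o u) (Theta x).
Proof.
move=> ux; apply: (@norm_cvg_le _ _ _ _ (fun n => cnorm (u n - x))) => // n.
by rewrite /= -parityB parity_norm.
Qed.

Lemma cnorm_closed_eq (f g : A -> A) :
  (forall u x, norm_cvg u x -> norm_cvg (f \o u) (f x)) ->
  (forall u x, norm_cvg u x -> norm_cvg (g \o u) (g x)) ->
  norm_closed [set x | f x = g x].
Proof.
move=> fc gc u x ufg ux; apply: (cnorm_cvg_unique (fc _ _ ux)).
have -> : f \o u = g \o u by apply/funext => n; exact: ufg.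
exact: gc.
Qed.

(** The fixed points of the square of the parity form a C*-algebra which contains
    the generators. *)
Lemma parityK : involutive Theta.
Proof.
suff sub : setT `<=` [set x : A | Theta (Theta x) = x] by move=> x; exact: sub.
rewrite -(car_gen F); apply: cstar_gen_min.
  split=> [u x uS ux||c x y|x y|x] /=.
  - by apply: (cnorm_closed_eq (f := Theta \o Theta) (g := id) _ _ uS ux) => // v y vy;
      do 2 apply: parity_cvg.
  - by rewrite !parity1.
  - by rewrite !parityD !parityZ => -> ->.
  - by rewrite !parity_mul => -> ->.
  - by rewrite !parity_star => ->.
by move=> _ [j jI [i ->]]; rewrite /= parity_ann// parityN parity_ann// opprK.
Qed.

Definition even_part x : A := (2^-1 : R[i]) *: (x + Theta x).
Definition odd_part x : A := (2^-1 : R[i]) *: (x - Theta x).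

Lemma parity_even_part x : Theta (even_part x) = even_part x.
Proof. by rewrite parityZ parityD parityK addrC. Qed.

Lemma parity_odd_part x : Theta (odd_part x) = - odd_part x.
Proof. by rewrite parityZ parityB parityK -scalerN opprB. Qed.

Lemma even_odd_part x : x = even_part x + odd_part x.
Proof.
rewrite -scalerDr addrACA subrr addr0.
by rewrite -mulr2n -scalerMnr scalerMnl -mulr_natr mulVf ?scale1r// pnatr_eq0.
Qed.

Lemma algA S : star_subalg (alg F S). Proof. exact: cstar_gen_alg. Qed.

Lemma alg_closed S : norm_closed (alg F S).
Proof. by case: (cstar_gen_subalg [set x | exists j, [/\ S j, j \in I & exists i :
    'I_(deg F j), x = ann i]]). Qed.

Lemma alg_sub S T : S `<=` T -> alg F S `<=` alg F T.
Proof. by move=> ST; apply: cstar_gen_sub => x [j [Sj jI e]]; exists j; split => //;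
    exact: ST. Qed.

Lemma alg_ann S j (i : 'I_(deg F j)) : S j -> j \in I -> alg F S (ann i).
Proof. by move=> Sj jI; apply: sub_cstar_gen; exists j; split => //; exists i. Qed.

Lemma parity_preim_subalg (V : set A) : cstar_subalg V -> cstar_subalg [set x | V (Theta x)].
Proof.
move=> [cV V1 VD VM Vs]; split=> [u x uV ux||c x y|x y|x] /=.
- by apply: (cV (Theta \o u)) (parity_cvg ux) => n; exact: uV.
- by rewrite parity1.
- by rewrite parityD parityZ; exact: VD.
- by rewrite parity_mul; exact: VM.
- by rewrite parity_star; exact: Vs.
Qed.

Lemma gen_parity (G : set A) x : (forall g, G g -> Theta g = - g) ->
  cstar_gen G x -> cstar_gen G (Theta x).
Proof.
move=> Godd; apply: (cstar_gen_min (S := [set x | cstar_gen G (Theta x)])).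
  exact/parity_preim_subalg/cstar_gen_subalg.
move=> g Gg /=; rewrite Godd//; apply: (subalgN (cstar_gen_alg G)).
exact: sub_cstar_gen.
Qed.

Lemma alg_parity S x : alg F S x -> alg F S (Theta x).
Proof. by apply: gen_parity => g [j [_ jI [i ->]]]; exact: parity_ann. Qed.

Lemma alg_even_part S x : alg F S x -> alg F S (even_part x).
Proof.
by move=> Sx; apply: (subalgZ (algA S)); apply: (subalgD (algA S)) => //; exact: alg_parity.
Qed.

Lemma alg_odd_part S x : alg F S x -> alg F S (odd_part x).
Proof.
by move=> Sx; apply: (subalgZ (algA S)); apply: (subalgB (algA S)) => //; exact: alg_parity.
Qed.

(** Both relations are closed under the operations of a C*-algebra, but only
    together: the involution exchanges them, up to an application of the parity. *)
Lemma gen_graded (G : set A) (a : A) : Theta a = - a ->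
  (forall g, G g -> [/\ Theta g = - g, a * g + g * a = 0 & star a * g + g * star a = 0]) ->
  forall y, cstar_gen G y -> a * y = Theta y * a /\ star a * y = Theta y * star a.
Proof.
move=> ao Ga; apply: cstar_gen_min => [|g /Ga[go ag asg]]; last first.
  by rewrite /= go !mulNr; split; apply/eqP; rewrite -addr_eq0; apply/eqP.
have cvgl b u x : norm_cvg u x -> norm_cvg (fun n => b * u n) (b * x).
  by apply: norm_cvgM; exact: norm_cvg_cst.
have cvgr b u x : norm_cvg u x -> norm_cvg (fun n => Theta (u n) * b) (Theta x * b).
  by move=> ux; apply: norm_cvgM; [exact: parity_cvg|exact: norm_cvg_cst].
split=> [u x uS ux||c x y [h1 h2] [h3 h4]|x y [h1 h2] [h3 h4]|x [h1 h2]] /=.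
- split.
    by apply: (cnorm_closed_eq (cvgl a) (cvgr a) _ ux) => n; case: (uS n).
  by apply: (cnorm_closed_eq (cvgl (star a)) (cvgr (star a)) _ ux) => n; case: (uS n).
- by rewrite parity1 !mulr1 !mul1r.
- by rewrite !mulrDr -!scalerAr h1 h2 h3 h4 parityD parityZ !mulrDl -!scalerAl.
- by rewrite parity_mul !mulrA h1 h2 -!mulrA h3 h4.
- move/(congr1 star): (h1); move/(congr1 star): (h2).
  rewrite !starM starK => /(congr1 Theta) k2 /(congr1 Theta) k1.
  move: k2 k1; rewrite !parity_mul !parity_star parityK ao starN.
  by rewrite !mulrN !mulNr => /oppr_inj -> /oppr_inj ->.
Qed.

(** For an annihilator this is [gen_graded]; the elements [x] with this property
    form a C*-algebra. *)
Lemma graded_commutation S T x y : (forall j, j \in I -> S j -> T j -> False) ->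
  alg F S x -> alg F T y ->
  (Theta y = y -> x * y = y * x) /\ (Theta y = - y -> x * y = y * Theta x).
Proof.
move=> ST Sx Ty.
have cvgl b u z : norm_cvg u z -> norm_cvg (fun n => b * u n) (b * z).
  by apply: norm_cvgM; exact: norm_cvg_cst.
have cvgr b u z : norm_cvg u z -> norm_cvg (fun n => u n * b) (z * b).
  by move=> uz; apply: norm_cvgM => //; exact: norm_cvg_cst.
suff : alg F S `<=` [set x | forall y, alg F T y -> (Theta y = y -> x * y = y * x) /\
    (Theta y = - y -> x * y = y * Theta x)].
  by move=> /(_ x Sx); apply.
apply: cstar_gen_min => [|_ [j [Sj jI [i ->]]] {Sx}{}y {}Ty] /=; last first.
  have [ay _] : ann i * y = Theta y * ann i /\ star (ann i) * y = Theta y * star (ann i).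
    apply: (gen_graded (parity_ann i jI) _ Ty) => _ [k [Tk kI [h ->]]].
    rewrite parity_ann// car_ann// car_star//; split=> //; case: eqP => //= jk.
    by case: (ST j) => //; rewrite jk.
  by rewrite ay parity_ann//; split=> ->; rewrite // mulrN mulNr.
split=> [u z uS uz||c x1 x2 h1 h2|x1 x2 h1 h2|x1 h1] {Ty}y Ty /=.
- split=> ye.
    by apply: (cnorm_closed_eq (cvgr y) (cvgl y) _ uz) => n; case: (uS n y Ty) => + _; exact.
  apply: (cnorm_closed_eq (cvgr y) (g := fun x => y * Theta x) _ _ uz).
    by move=> v t vt; apply: cvgl; exact: parity_cvg.
  by move=> n; case: (uS n y Ty) => _; exact.
- by rewrite parity1 mulr1 mul1r.
- have [e1 o1] := h1 y Ty; have [e2 o2] := h2 y Ty.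
  split=> ye; rewrite mulrDl -scalerAl.
    by rewrite e1// e2// mulrDr -scalerAr.
  by rewrite o1// o2// parityD parityZ mulrDr -scalerAr.
- have [e1 o1] := h1 y Ty; have [e2 o2] := h2 y Ty.
  split=> ye; rewrite -mulrA.
    by rewrite e2// mulrA e1// mulrA.
  by rewrite o2// mulrA o1// parity_mul mulrA.
- have Tsy : alg F T (star y) by exact: (subalg_star (algA T)).
  have [e1 o1] := h1 _ Tsy; split=> ye.
    move/(congr1 star): (e1 (etrans (parity_star F y) (congr1 star ye))).
    by rewrite !starM starK.
  have syo : Theta (star y) = - star y by rewrite parity_star ye starN.
  move/(congr1 (Theta \o star)): (o1 syo).
  rewrite /= !starM starK !parity_mul !parity_star parityK ye.
  by rewrite mulNr mulrN => /oppr_inj.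
Qed.

Lemma even_commute S T x y : (forall j, j \in I -> S j -> T j -> False) ->
  alg F S x -> alg F T y -> Theta y = y -> x * y = y * x.
Proof. by move=> ST Sx Ty; have [] := graded_commutation ST Sx Ty. Qed.

Lemma graded_swap S T x y : (forall j, j \in I -> S j -> T j -> False) ->
  alg F S x -> alg F T y -> x * y = even_part y * x + odd_part y * Theta x.
Proof.
move=> ST Sx Ty; rewrite {1}(even_odd_part y) mulrDr.
have [+ _] := graded_commutation ST Sx (alg_even_part Ty).
move=> /(_ (parity_even_part y)) ->.
have [_ +] := graded_commutation ST Sx (alg_odd_part Ty).
by move=> /(_ (parity_odd_part y)) ->.
Qed.

(** Moving right factors past left ones at the cost of a parity, the span of the
    products is seen to be a *-algebra; it contains the generators, so it is dense. *)
Lemma alg_le_ind n (P : set A) : norm_closed P -> lin_subspace P ->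
  (forall x y, alg_le F (n - 1) x -> alg_seg F n (n + 1) y -> P (x * y)) ->
  alg_le F (n + 1) `<=` P.
Proof.
move=> cP sP PM z zn.
set S := [set j : int | j <= n - 1]; set T := [set j : int | n <= j <= n + 1].
have TS j : j \in I -> T j -> S j -> False by rewrite /T /S /=; lia.
have [aS aT] := (algA S, algA T).
pose G := [set z : A | exists x y, [/\ alg F S x, alg F T y & z = x * y]].
have GM x y : alg F S x -> alg F T y -> lin_span G (x * y).
  by move=> Sx Ty; apply: sub_lin_span; exists x, y.
have GD x y : lin_span G x -> lin_span G y -> lin_span G (x + y).
  by move=> Gx Gy; have [_ h] := lin_span_lin G; have := h 1 x y Gx Gy; rewrite scale1r.
have aG : star_subalg (lin_span G).
  apply: lin_span_alg.
  - by exists 1, 1; rewrite mulr1; split=> //; exact: subalg1.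
  - move=> _ _ [x [y [Sx Ty ->]]] [x' [y' [Sx' Ty' ->]]].
    rewrite mulrA -[x * y * x']mulrA (graded_swap TS Ty Sx') mulrDr mulrDl.
    rewrite !mulrA -[_ * y * y']mulrA -[_ * Theta y * y']mulrA.
    apply: GD; apply: GM.
    + exact: (subalgM aS Sx (alg_even_part Sx')).
    + exact: (subalgM aT Ty Ty').
    + exact: (subalgM aS Sx (alg_odd_part Sx')).
    + exact: (subalgM aT (alg_parity Ty) Ty').
  - move=> _ [x [y [Sx Ty ->]]]; rewrite starM.
    have [Sxs Tys] := (subalg_star aS Sx, subalg_star aT Ty).
    rewrite (graded_swap TS Tys Sxs).
    by apply: GD; apply: GM => //;
        first [exact: alg_even_part|exact: alg_odd_part|exact: alg_parity].
have [|u Gu uz] := cstar_gen_closure aG _ zn.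
  move=> _ [j [/= jn jI [i ->]]].
  have [jn1|jn1] := leP j (n - 1).
    by rewrite -[ann i]mulr1; apply: GM; [exact: alg_ann|exact: (subalg1 aT)].
  rewrite -[ann i]mul1r; apply: GM; first exact: (subalg1 aS).
  by apply: alg_ann => //; rewrite /T /=; lia.
apply: (cP u) => // k; apply: (Gu k) => // _ [x [y [Sx Ty ->]]].
exact: PM.
Qed.

End Fermions.

(** * Finite dimension *)

Section FiniteDimension.
Variables (R : realType) (A : cstarType R).
Implicit Types (x y : A) (V : set A).

(** The spanning family lies in the set itself, which the Gram-Schmidt process
    needs in order to stay where the state is faithful. *)
Definition fin_spanned V : Prop := exists (K : finType) (e : K -> A),
  (forall k, V (e k)) /\
  forall x, V x -> exists c : K -> R[i], x = \sum_k c k *: e k.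

(** The only consequence of finite dimension that is used for the centres.  Unlike
    the existence of a spanning family inside the set, it passes to subsets at once. *)
Definition fin_dependent V : Prop := exists N, forall x : 'I_N -> A,
  (forall i, V (x i)) ->
  exists2 c : 'I_N -> R[i], (exists i, c i != 0) & \sum_i c i *: x i = 0.

Lemma fin_dependent_sub V W : V `<=` W -> fin_dependent W -> fin_dependent V.
Proof. by move=> VW [N NP]; exists N => x Vx; apply: NP => i; exact: VW. Qed.

Lemma fin_spanned_dependent V : fin_spanned V -> fin_dependent V.
Proof.
move=> [K [e [_ eP]]]; exists #|K|.+1 => x Vx.
have [c cP] := choice (fun i => eP _ (Vx i)).
pose M : 'M[R[i]]_(#|K|.+1, #|K|) := \matrix_(i, k) c i (enum_val k).
have : kermx M != 0.
  rewrite -mxrank_eq0 mxrank_ker -lt0n subn_gt0.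
  by apply: leq_ltn_trans (rank_leq_col M) _.
move=> /rowV0Pn[u /sub_kermxP uM un0]; exists (u 0).
  apply/existsP; apply: contraNT un0; rewrite negb_exists => /forallP u0.
  by apply/eqP/rowP => i; rewrite mxE; apply/eqP; have := u0 i; rewrite negbK.
under eq_bigr do rewrite cP scaler_sumr.
rewrite exchange_big /= big1// => k _.
under eq_bigr do rewrite scalerA.
rewrite -scaler_suml.
have /rowP /(_ (enum_rank k)) := uM; rewrite !mxE => e0.
suff -> : \sum_i u 0 i * c i k = 0 by rewrite scale0r.
by apply: etrans e0; apply: eq_bigr => i _; rewrite mxE enum_rankK.
Qed.

Variable phi : A -> R[i].
Hypothesis phi_state : is_state phi.

Definition gs_proj (es : seq A) x : A := \sum_(e <- es) phi (star e * x) *: e.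

Lemma gs_proj_linear es (c : R[i]) x y :
    gs_proj es (c *: x + y) = c *: gs_proj es x + gs_proj es y.
Proof.
rewrite /gs_proj scaler_sumr -big_split; apply: eq_bigr => e _.
by rewrite mulrDr -scalerAr stateD// stateZ// scalerDl scalerA.
Qed.

Lemma gs_proj0 es : gs_proj es 0 = 0.
Proof. by rewrite /gs_proj big1// => e _; rewrite mulr0 state0// scale0r. Qed.

Lemma gs_fixed_lin es : lin_subspace [set x | gs_proj es x = x].
Proof.
split=> [|c x y ex ey] /=; first exact: gs_proj0.
by rewrite gs_proj_linear ex ey.
Qed.

Lemma lin_subspace_sum V (T : Type) (r : seq T) (c : T -> R[i]) (f : T -> A) :
    lin_subspace V ->
  (forall t, V (f t)) -> V (\sum_(t <- r) c t *: f t).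
Proof.
move=> [V0 VD] Vf; elim: r => [|t r IH]; first by rewrite big_nil.
by rewrite big_cons; exact: VD.
Qed.

Lemma lin_subspace_sum_seq V (r : seq A) (c : A -> R[i]) : lin_subspace V ->
  (forall t, t \in r -> V t) -> V (\sum_(t <- r) c t *: t).
Proof.
move=> [V0 VD]; elim: r => [|t r IH] Vr; first by rewrite big_nil.
rewrite big_cons; apply: VD; first by apply: Vr; rewrite mem_head.
by apply: IH => s sr; apply: Vr; rewrite inE sr orbT.
Qed.

(** Orthogonalization for the inner product [phi (star x * y)].  Orthonormality of
    [es] appears in the form that the projection [gs_proj es] fixes the span. *)
Lemma gram_schmidt V (s : seq A) : lin_subspace V -> faithful_on V phi ->
  (forall x, x \in s -> V x) -> exists es,
  [/\ forall e, e \in es -> V e, forall e, e \in es -> gs_proj es e = e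
    & forall x, x \in s -> gs_proj es x = x].
Proof.
move=> sV fV; elim: s => [|v s IH] Vs; first by exists [::].
have [|es [Ves fes fs]] := IH; first by move=> x xs; apply: Vs; rewrite inE xs orbT.
(* v' is the component of v orthogonal to the span of es. *)
pose v' := v - gs_proj es v.
have PP x : gs_proj es (gs_proj es x) = gs_proj es x.
  by apply: (lin_subspace_sum_seq _ (gs_fixed_lin es)).
have Pv' : gs_proj es v' = 0.
  by have := gs_proj_linear es (-1) (gs_proj es v) v; rewrite !scaleN1r PP addNr addrC.
have [v0|vn0] := eqVneq v' 0.
  exists es; split=> // x; rewrite inE => /predU1P[->|]; last exact: fs.
  by apply/esym/eqP; rewrite -subr_eq0 -/v' v0.
have Vv : V v by apply: Vs; rewrite mem_head.
have Vv' : V v'.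
  have := lin_subspace_sum_seq (fun e => - phi (star e * v)) sV Ves.
  under eq_bigr do rewrite scaleNr.
  rewrite sumrN => Vp; have := sV.2 1 _ _ Vv Vp.
  by rewrite scale1r.
(* The squares of these inner products add up to <v', gs_proj es v'> = 0. *)
have orth e : e \in es -> phi (star e * v') = 0.
  have : phi (star v' * gs_proj es v') == 0 by rewrite Pv' mulr0 state0.
  rewrite mulr_sumr state_sum//.
  have cc e' : phi (star v' * (phi (star e' * v') *: e')) = `|phi (star e' * v')| ^+ 2.
    by rewrite -scalerAr stateZ// normCK -state_star// starM starK.
  under eq_bigr do rewrite cc.
  rewrite psumr_eq0 => [/allP h /h|e' _]; last by rewrite exprn_ge0.
  by rewrite /= expf_eq0 normr_eq0 => /eqP.
have orth' e : e \in es -> phi (star v' * e) = 0.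
  by move=> ees; rewrite -[e]starK -starM state_star// orth// rmorph0.
have n0 : phi (star v' * v') != 0.
  by apply: contra_neq vn0; exact: fV.
have nn : 0 <= phi (star v' * v') := state_ge0 phi_state v'.
set n := phi _ in n0 nn; pose k := sqrtC n.
have kr : k^* = k by apply/CrealP; apply: ger0_real; rewrite sqrtC_ge0.
have kn0 : k != 0 by rewrite sqrtC_eq0.
have kk : k * k = n by rewrite -expr2 sqrtCK.
pose w := k^-1 *: v'.
have sw x : phi (star w * x) = k^-1 * phi (star v' * x).
  by rewrite starZ -scalerAl stateZ// fmorphV /= kr.
have P'E x : gs_proj (w :: es) x = phi (star w * x) *: w + gs_proj es x.
  by rewrite /gs_proj big_cons.
have P'es e : e \in es -> gs_proj (w :: es) e = e.
  by move=> ees; rewrite P'E sw orth'// mulr0 scale0r add0r fes.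
have P'P x : gs_proj (w :: es) (gs_proj es x) = gs_proj es x.
  by apply: (lin_subspace_sum_seq _ (gs_fixed_lin (w :: es))) => e /P'es.
have P'v' : gs_proj (w :: es) v' = v'.
  by rewrite P'E Pv' addr0 sw -/n scalerA -kk mulKf// mulfV// scale1r.
have [f0 fD] := gs_fixed_lin (w :: es).
exists (w :: es); split=> x; rewrite inE => /predU1P[->|].
- by have := sV.2 k^-1 _ _ Vv' sV.1; rewrite addr0.
- exact: Ves.
- by have := fD k^-1 _ _ P'v' f0; rewrite addr0.
- exact: P'es.
- have := fD 1 _ _ P'v' (P'P v); rewrite scale1r /v' subrK; exact.
- by move=> /fs <-; exact: P'P.
Qed.

(** The projection given by the Gram-Schmidt process is continuous and fixes [V], so
    a limit of elements of [V] is fixed as well, and thus lies in [V]. *)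
Lemma fin_spanned_closed V : lin_subspace V -> faithful_on V phi ->
  fin_spanned V -> norm_closed V.
Proof.
move=> sV fV [K [b [Vb bP]]].
have [|es [Ves _ fs]] := gram_schmidt (s := [seq b k | k <- enum K]) sV fV.
  by move=> _ /mapP[k _ ->].
have PV x : V x -> gs_proj es x = x.
  move=> /bP[c ->]; apply: (lin_subspace_sum _ _ (gs_fixed_lin es)) => k.
  by apply: fs; apply: map_f; rewrite mem_enum.
move=> u x Vu ux; suff -> : x = gs_proj es x by exact: lin_subspace_sum_seq.
apply: (cnorm_cvg_unique ux).
have -> : u = gs_proj es \o u by apply/funext => n; rewrite /= PV.
rewrite /gs_proj; elim: es {Ves fs PV} => [|e es IH] /=.
  under eq_fun do rewrite big_nil; rewrite big_nil; exact: norm_cvg_cst.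
under eq_fun do rewrite /= big_cons; rewrite big_cons.
apply: norm_cvgD => //.
apply: (@norm_cvg_le _ _ _ _ (fun n => cnorm (star e) * cnorm (u n - x) * cnorm e)).
  move=> n; rewrite -scalerBl cnormZ_le ler_wpM2r ?cnorm_ge0//.
  rewrite -stateB// -mulrBr; apply: le_trans (cnormM _ _).
  by rewrite -lecR RRe_real ?normr_real// state_le.
rewrite -(mul0r (cnorm e)); apply: cvgMl; rewrite -(mulr0 (cnorm (star e))).
exact: cvgMr.
Qed.

Lemma fin_spanned_gen V (G : set A) : faithful_on V phi -> fin_spanned V ->
  star_subalg V -> G `<=` V -> V `<=` cstar_gen G -> fin_spanned (cstar_gen G).
Proof.
move=> fV sV aV GV VG.
suff -> : cstar_gen G = V by [].
apply/seteqP; split=> //; apply: cstar_gen_min => //.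
case: (aV) => V1 VD VM Vs; split => //.
apply: fin_spanned_closed => //; split=> [|c x y Vx Vy]; first exact: (subalg0 aV).
exact: VD.
Qed.

End FiniteDimension.

Section SiteDimension.
Variables (R : realType) (A : cstarType R) (F : fermion A) (phi : A -> R[i]).
Hypothesis phi_state : is_state phi.
Local Notation Theta := (parity F).

(** A mode which is in the graded commutation relation with an algebra [T] adds the
    four basis elements of a matrix algebra: the combinations of 1, [a], [star a]
    and [star a * a] with coefficients in [T] on the left form a *-algebra. *)
Lemma fin_spanned_mode (G : set A) (a : A) :
  Theta a = - a -> a * a = 0 -> star a * a + a * star a = 1 ->
  (forall g, G g -> [/\ Theta g = - g, a * g + g * a = 0 & star a * g + g * star a = 0]) ->
  faithful_on (cstar_gen (G `|` [set a])) phi ->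
  fin_spanned (cstar_gen G) -> fin_spanned (cstar_gen (G `|` [set a])).
Proof.
move=> ao a2 aa Ga fG [K [e [eT eP]]].
set T := cstar_gen G in eT eP *.
have aT : star_subalg T := cstar_gen_alg G.
have at_ t : T t -> a * t = Theta t * a by move=> /(gen_graded ao Ga)[].
have ast t : T t -> star a * t = Theta t * star a by move=> /(gen_graded ao Ga)[].
have ThT t : T t -> T (Theta t) by apply: gen_parity => g /Ga[].
have as2 : star a * star a = 0 by rewrite -starM a2 star0.
have aas : a * star a = 1 - star a * a by rewrite -aa addrAC subrr add0r.
have aasa : a * star a * a = a by rewrite aas mulrBl mul1r -mulrA a2 mulr0 subr0.
pose form t0 t1 t2 t3 := t0 + t1 * a + t2 * star a + t3 * (star a * a).
pose V := [set x | exists t0 t1 t2 t3, [/\ T t0, T t1, T t2, T t3 & x = form t0 t1 t2 t3]].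
have T0 : T 0 := subalg0 aT.
have VT t : T t -> V t.
  by move=> Tt; exists t, 0, 0, 0; split=> //; rewrite /form !mul0r !addr0.
have Va : V a.
  by exists 0, 1, 0, 0; split=> //;
      [exact: (subalg1 aT)|rewrite /form !mul0r !addr0 mul1r add0r].
have VD (c : R[i]) x y : V x -> V y -> V (c *: x + y).
  move=> [x0 [x1 [x2 [x3 [? ? ? ? ->]]]]] [y0 [y1 [y2 [y3 [? ? ? ? ->]]]]].
  have TD u v : T u -> T v -> T (c *: u + v).
    by move=> Tu Tv; apply: (subalgD aT) => //; exact: (subalgZ aT).
  exists (c *: x0 + y0), (c *: x1 + y1), (c *: x2 + y2), (c *: x3 + y3).
  split; try exact: TD.
  rewrite /form !scalerDr !mulrDl -!scalerAl.
  by rewrite [LHS]addrACA; congr (_ + _); rewrite [LHS]addrACA; congr (_ + _);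
      rewrite [LHS]addrACA.
have V0 : V 0 by exact: VT.
have VDD x y : V x -> V y -> V (x + y).
  by move=> Vx Vy; rewrite -[x]scale1r; exact: VD.
have V4 x y z t : V x -> V y -> V z -> V t -> V (x + y + z + t).
  by move=> Vx Vy Vz Vt; apply: (VDD) => //; apply: (VDD) => //; exact: VDD.
have VZ (c : R[i]) x : V x -> V (c *: x).
  by move=> Vx; rewrite -[_ *: _]addr0; exact: VD.
have VlT t x : T t -> V x -> V (t * x).
  move=> Tt [x0 [x1 [x2 [x3 [? ? ? ? ->]]]]].
  exists (t * x0), (t * x1), (t * x2), (t * x3).
  split; try exact: (subalgM aT).
  by rewrite /form !mulrDr !mulrA.
have Vla x : V x -> V (a * x).
  move=> [x0 [x1 [x2 [x3 [T0' T1 T2 T3 ->]]]]].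
  exists (Theta x2), (Theta x0 + Theta x3), 0, (- Theta x2).
  split; first [exact: ThT|exact: (subalgN aT (ThT _ T2))|exact: (subalgD aT (ThT _ T0')
      (ThT _ T3))|exact: T0|idtac].
  have e1 : a * (x1 * a) = 0 by rewrite mulrA at_// -mulrA a2 mulr0.
  have e2 : a * (x2 * star a) = Theta x2 - Theta x2 * (star a * a).
    by rewrite mulrA at_// -mulrA aas mulrBr mulr1.
  have e3 : a * (x3 * (star a * a)) = Theta x3 * a.
    by rewrite mulrA at_// -mulrA [a * (_ * _)]mulrA aasa.
  rewrite /form !mulrDr e1 e2 e3 at_// addr0 mul0r addr0 mulrDl mulNr.
  by rewrite addrAC [LHS]addrA [in RHS]addrAC [in RHS]addrC !addrA.
have Vlas x : V x -> V (star a * x).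
  move=> [x0 [x1 [x2 [x3 [T0' T1 T2 T3 ->]]]]].
  exists 0, 0, (Theta x0), (Theta x1).
  split=> //; try exact: ThT.
  rewrite /form !mulrDr !mulrA !ast//.
  rewrite -(mulrA (Theta x2)) as2 mulr0 addr0.
  by rewrite -(mulrA (Theta x3)) as2 mulr0 mul0r addr0 ?add0r.
have aV : star_subalg V.
  split=> //.
  - by apply: (VT); exact: (subalg1 aT).
  - move=> x y [s0 [s1 [s2 [s3 [? ? ? ? ->]]]]] Vy; rewrite /form !mulrDl.
    apply: (V4); try rewrite -mulrA; apply: (VlT) => //.
    + exact: Vla.
    + exact: Vlas.
    + by rewrite -mulrA; apply: (Vlas); exact: Vla.
  - move=> x [s0 [s1 [s2 [s3 [? ? ? ? ->]]]]]; rewrite /form !starD !starM starK.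
    have sT t : T t -> V (star t) by move=> Tt; apply: (VT); exact: (subalg_star aT).
    apply: (V4); first exact: sT.
    + by apply: (Vlas); exact: sT.
    + by apply: (Vla); exact: sT.
    + by rewrite -mulrA; apply: (Vlas); apply: (Vla); exact: sT.
have aGa : star_subalg (cstar_gen (G `|` [set a])) := cstar_gen_alg _.
have Ga_a : cstar_gen (G `|` [set a]) a by apply: sub_cstar_gen; right.
have Ga_T : T `<=` cstar_gen (G `|` [set a]) by apply: cstar_gen_sub => x; left.
have VG : V `<=` cstar_gen (G `|` [set a]).
  move=> _ [x0 [x1 [x2 [x3 [T0' T1 T2 T3 ->]]]]].
  have gM := subalgM aGa; have gs := subalg_star aGa.
  have gD := subalgD aGa; apply: (gD); [apply: (gD); [apply: (gD)|]|]; first exact: Ga_T.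
  - by apply: (gM) => //; exact: Ga_T.
  - by apply: (gM); [exact: Ga_T|exact: gs].
  - by apply: (gM); [exact: Ga_T|apply: (gM) => //; exact: gs].
apply: (@fin_spanned_gen _ _ _ phi_state V) => //.
- by move=> x Vx; apply: fG; exact: VG.
- exists ((K + K) + (K + K))%type, (fun k => match k with
    | inl (inl k) => e k | inl (inr k) => e k * a
    | inr (inl k) => e k * star a | inr (inr k) => e k * (star a * a) end).
  split.
    move=> [[k|k]|[k|k]]; first exact: VT.
    + by exists 0, (e k), 0, 0; split=> //; rewrite /form !mul0r !addr0 add0r.
    + by exists 0, 0, (e k), 0; split=> //; rewrite /form !mul0r !addr0 add0r.
    + by exists 0, 0, 0, (e k); split=> //; rewrite /form !mul0r !addr0 add0r.
  move=> _ [x0 [x1 [x2 [x3 [/eP[c0 ->] /eP[c1 ->] /eP[c2 ->] /eP[c3 ->] ->]]]]].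
  exists (fun k => match k with
    | inl (inl k) => c0 k | inl (inr k) => c1 k
    | inr (inl k) => c2 k | inr (inr k) => c3 k end).
  rewrite /form !big_sumType /= !mulr_suml -!addrA.
  congr (_ + _); congr (_ + _); last congr (_ + _).
  + by apply: eq_bigr => k _; rewrite -scalerAl.
  + by apply: eq_bigr => k _; rewrite -scalerAl.
  + by apply: eq_bigr => k _; rewrite -scalerAl.
- move=> x [Gx|->] //; first by apply: (VT); exact: sub_cstar_gen.
Qed.

(** The modes of the site are added one by one. *)
Lemma fin_spanned_site j : j \in sites F -> faithful_on (alg_seg F j j) phi ->
  fin_spanned (alg_seg F j j).
Proof.
move=> jI fj; pose G (l : seq 'I_(deg F j)) := [set x : A | exists2 i, i \in l & x = ann i].
have GE : alg_seg F j j = cstar_gen (G (enum 'I_(deg F j))).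
  congr cstar_gen; apply/seteqP; split=> x.
    move=> [k [/= kj kI [i ->]]]; have e : k = j by lia.
    by rewrite {k kj kI}e in i *; exists i; rewrite ?mem_enum.
  by move=> [i _ ->]; exists j; split=> //=; [lia|exists i].
have Gle l : cstar_gen (G l) `<=` alg_seg F j j.
  by rewrite GE; apply: cstar_gen_sub => x [i _ ->]; exists i => //; rewrite mem_enum.
rewrite GE; elim: (enum _) (enum_uniq 'I_(deg F j)) => [_|i l IH /= /andP[il ul]].
  apply: (@fin_spanned_gen _ _ _ phi_state [set x | exists c : R[i], x = c *: 1]).
  - move=> x [c ->]; apply: fj; apply: (subalgZ (algA F _)).
    exact: (subalg1 (algA F _)).
  - exists 'I_1, (fun=> 1); split=> [_|x [c ->]]; first by exists 1; rewrite scale1r.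
    by exists (fun=> c); rewrite big_ord1.
  - split; first by exists 1; rewrite scale1r.
    + by move=> c x y [a ->] [b ->]; exists (c * a + b); rewrite scalerDl scalerA.
    + move=> x y [a ->] [b ->]; exists (a * b).
      by rewrite -scalerAl mul1r scalerA.
    + by move=> x [a ->]; exists (a^*); rewrite starZ star1.
  - by move=> x [].
  - move=> x [c ->]; apply: (subalgZ (cstar_gen_alg _)).
    exact: (subalg1 (cstar_gen_alg _)).
have GS : G (i :: l) = G l `|` [set ann i].
  apply/seteqP; split=> x.
    move=> [h]; rewrite inE => /predU1P[->|hl] ->; first by right.
    by left; exists h.
  by move=> [[h hl ->]|->]; [exists h; rewrite ?inE ?hl ?orbT|exists i; rewrite ?mem_head].
rewrite GS; apply: fin_spanned_mode.
- exact: parity_ann.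
- have := car_ann i i jI jI; rewrite -mulr2n -scaler_nat => /eqP.
  by rewrite scaler_eq0 pnatr_eq0 => /eqP.
- by rewrite car_star// !eqxx.
- move=> _ [h hl ->]; rewrite parity_ann// car_ann// car_star// eqxx /=.
  by case: eqP => // /val_inj ih; rewrite ih hl in il.
- by rewrite -GS => x Gx; apply: fj; exact: Gle Gx.
- exact: IH.
Qed.

End SiteDimension.

(** * Minimal projections *)

Section MinimalProjections.
Variables (R : realType) (A : cstarType R).
Implicit Types (x y z p q : A).

(* An algebra Z of pairwise commuting elements, in place of the centre. *)
Variable Z : set A.
Hypothesis aZ : star_subalg Z.
Hypothesis commZ : forall x y, Z x -> Z y -> x * y = y * x.

(** The product is a projection below both. *)
Lemma minimal_projection_orthogonal p q :
  minimal_projection Z p -> minimal_projection Z q -> p != q -> p * q = 0.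
Proof.
move=> [Zp [ps pp] _ pmin] [Zq [qs qq] _ qmin] pq.
have Zpq : Z (p * q) by exact: (subalgM aZ).
have proj : is_projection (p * q).
  split; first by rewrite starM ps qs commZ.
  by rewrite mulrA -[p * q * p]mulrA (commZ Zq Zp) mulrA pp -mulrA qq.
have pqp : p * q * p = p * q by rewrite -mulrA (commZ Zq Zp) mulrA pp.
have pqq : p * q * q = p * q by rewrite -mulrA qq.
have [//|e1] := pmin _ Zpq proj pqp; have [//|e2] := qmin _ Zpq proj pqq.
by rewrite -e1 e2 eqxx in pq.
Qed.

Lemma cstar_sqr_neq0 y : y != 0 -> star y * y != 0.
Proof.
apply: contra_neq => yy; apply: cnorm0_eq0.
have : cnorm y ^+ 2 == 0 by rewrite -cnorm_starM yy cnorm0.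
by rewrite expf_eq0 => /eqP.
Qed.

(** A polynomial in [z] annihilates [p]; splitting off its linear factors one by one
    yields a vector [y = g(z) p] with [z y = a y].  Any polynomial in [z] acts as a
    scalar on [star y * y], so this element is a multiple of a projection below
    [p], that is, of [p]. *)
Lemma minimal_projection_eigen p z : fin_dependent Z -> minimal_projection Z p ->
  Z z -> star z = z -> exists c : R[i], z * p = c *: p.
Proof.
move=> finZ [Zp [ps pp] pn0 pmin] Zz zs.
have [N dep] := finZ.
have ZX n : Z (z ^+ n) by elim: n => [|n IH]; [exact: (subalg1 aZ)|rewrite exprS;
    exact: (subalgM aZ)].
have [|c [i ci] cz] := dep (fun i => z ^+ i * p); first by move=> i; exact: (subalgM aZ).
pose P := \poly_(k < N) (if insub k is Some i then c i else 0).
have P0 : P != 0.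
  apply/eqP => /(congr1 (fun P : {poly R[i]} => P`_i)).
  rewrite coef_poly ltn_ord coef0; case: insubP => [j _ /val_inj ->|]; last
      by rewrite ltn_ord.
  by apply/eqP.
have Pz : horner_alg z P * p = 0.
  rewrite /P poly_def rmorph_sum /= mulr_suml -[RHS]cz; apply: eq_bigr => k _.
  case: insubP => [j _ /val_inj ->|]; last by rewrite ltn_ord.
  by rewrite linearZ rmorphXn /= horner_algX mulr_algl scalerAl.
have [r rE] := closed_field_poly_normal P.
have rz : (\prod_(a <- r) (z - a%:A)) * p = 0.
  move: Pz; rewrite rE linearZ rmorph_prod /= mulr_algl -scalerAl.
  under eq_bigr do rewrite rmorphB /= horner_algX horner_algC.
  by move=> /eqP; rewrite scaler_eq0 lead_coef_eq0 (negPf P0) => /eqP.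
(* The last clause records that y is a polynomial in z, times p. *)
pose good y := [/\ Z y, y * p = y & forall a s, z * s = a *: s -> p * s = s -> exists k :
    R[i], y * s = k *: s].
have ZA a : Z (z - a%:A) by apply: (subalgB aZ) => //; apply: (subalgZ aZ);
    exact: (subalg1 aZ).
have goodA a y : good y -> good ((z - a%:A) * y).
  move=> [Zy yp ys]; split; [exact: (subalgM aZ)|by rewrite -mulrA yp|].
  move=> b s zb ps_; have [k yk] := ys b s zb ps_; exists (k * (b - a)).
  by rewrite -mulrA yk -scalerAr mulrBl zb -scalerAl mul1r -scalerBl scalerA.
have [a [y [[Zy yp ys] yn0 zy]]] : exists a y, [/\ good y, y != 0 & z * y = a *: y].
  have gen : forall x, good x -> x != 0 -> (\prod_(b <- r) (z - b%:A)) * x = 0 ->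
      exists b y, [/\ good y, y != 0 & z * y = b *: y].
    elim: r {rE rz} => [|b r IH] x gx xn0.
      by rewrite big_nil mul1r => x0; rewrite x0 eqxx in xn0.
    rewrite big_cons => rx; have [x0|xn] := eqVneq ((z - b%:A) * x) 0.
      exists b, x; split=> //; apply/eqP; rewrite -subr_eq0.
      by rewrite -x0 mulrBl -scalerAl mul1r.
    apply: IH xn _; first exact: goodA.
    rewrite mulrA -rx; congr (_ * x); apply: commZ => //.
    by apply: (big_ind Z) => //; [exact: (subalg1 aZ)|exact: (subalgM aZ)].
  apply: gen rz => //; split=> // a s _ ps1; exists 1.
  by rewrite ps1 scale1r.
have Zys : Z (star y) by exact: (subalg_star aZ).
pose s := star y * y; have Zs : Z s by exact: (subalgM aZ).
have ss : star s = s by rewrite starM starK.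
have zs_ : z * s = a *: s.
  by rewrite /s mulrA (commZ Zz Zys) -mulrA zy -scalerAr.
have psp : p * star y = star y by rewrite -{1}ps -starM yp.
have [|k yk] := ys a s zs_; first by rewrite /s mulrA psp.
have ysk : star y * s = k^* *: s.
  by rewrite -[LHS]starK starM starK ss (commZ Zs Zy) yk starZ ss.
have sn0 : s != 0 by exact: cstar_sqr_neq0.
(* So s is, up to normalization, a projection. *)
have ssk : s * s = `|k| ^+ 2 *: s.
  by rewrite {1}/s -mulrA yk -scalerAr ysk scalerA normCK.
have kn0 : `|k| ^+ 2 != 0.
  apply: contra_neq (cstar_sqr_neq0 sn0) => k0.
  by rewrite ss ssk k0 scale0r.
pose e := (`|k| ^+ 2)^-1 *: s.
have kr : ((`|k| ^+ 2)^-1)^* = (`|k| ^+ 2)^-1.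
  by apply/CrealP; rewrite realV realX ?normr_real.
have Ze : Z e by exact: (subalgZ aZ).
have eproj : is_projection e.
  split; first by rewrite starZ kr ss.
  by rewrite /e -scalerAr -scalerAl ssk [X in _ *: X]scalerA mulVf// scale1r.
have [|e0|eP] := pmin e Ze eproj.
- by rewrite /e -scalerAl /s -mulrA yp.
- by move/eqP: e0; rewrite scaler_eq0 invr_eq0 (negPf kn0) (negPf sn0).
- by exists a; rewrite -eP /e -scalerAr zs_ !scalerA mulrC.
Qed.

(** Orthogonal non-zero projections are linearly independent. *)
Lemma minimal_projection_finite : fin_dependent Z -> finite_set (minimal_projection Z).
Proof.
move=> [N dep]; apply: contrapT => inf.
have [B BP NB] := infinite_set_fset N inf.
pose x (i : 'I_N) := nth 0 B i.
have xB i : x i \in B by apply: mem_nth; exact: leq_trans (ltn_ord i) NB.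
have xm i : minimal_projection Z (x i) by apply: BP; exact: xB.
have [|c [i ci] cx] := dep x; first by move=> i; case: (xm i).
have : x i * \sum_j c j *: x j = 0 by rewrite cx mulr0.
rewrite mulr_sumr (bigD1 i)//= big1 => [|j ji]; last first.
  rewrite -scalerAr minimal_projection_orthogonal ?scaler0//.
  rewrite /x nth_uniq ?fset_uniq//; last 2 first.
    exact: leq_trans (ltn_ord i) NB. exact: leq_trans (ltn_ord j) NB.
  by rewrite eq_sym.
have [_ [_ xx] xn0 _] := xm i.
rewrite addr0 -scalerAr xx => /eqP.
by rewrite scaler_eq0 (negPf ci) (negPf xn0).
Qed.

End MinimalProjections.

(** * Integration over the path space *)

Section PathSpace.
Variables (R : realType) (A : cstarType R).
Implicit Types (w v : paths A) (S : set (paths A)).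

Definition cylinder v (k : int) (m : nat) : set (paths A) :=
  [set w | forall j, k <= j < k + m%:Z -> w j = v j].

Lemma seq_open_measurable (U : set (seq_space A)) : open U -> measurable (U : set (paths A)).
Proof. by move=> oU; apply: sub_sigma_algebra. Qed.

Lemma coordinate_open (j : int) (O : set (set A)) :
  open ([set w | O (w j)] : set (seq_space A)).
Proof.
have h : continuous ((fun w => w j) : seq_space A -> discrete_topology (set A)) :=
  @proj_continuous _ (fun=> discrete_topology (set A)) j.
have oO : open (O : set (discrete_topology (set A))) by exact: discrete_open.
by apply: (open_comp _ oO) => w _; exact: h.
Qed.

Lemma cylinder_open v k m : open (cylinder v k m : set (seq_space A)).
Proof.
elim: m => [|m IH].
  have -> : cylinder v k 0 = setT by apply/seteqP; split=> // w _ j; lia.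
  exact: openT.
have -> : cylinder v k m.+1 = cylinder v k m `&` [set w | w (k + m%:Z) = v (k + m%:Z)].
  apply/seteqP; split=> w.
    by move=> h; split=> [j jk|/=]; apply: h; lia.
  move=> [h1 h2] j jk; have [->//|jm] := eqVneq j (k + m%:Z).
  by apply: h1; lia.
exact/(openI IH)/(coordinate_open _ [set v (k + m%:Z)]).
Qed.

(** A set which is determined by finitely many coordinates is a union of cylinders. *)
Lemma local_open (U : set (paths A)) k m :
  (forall v w, U v -> cylinder v k m w -> U w) -> open (U : set (seq_space A)).
Proof.
move=> Uloc; have -> : U = \bigcup_(v in U) cylinder v k m.
  by apply/seteqP; split=> w; [exists w|move=> [v Uv]; exact: Uloc].
by apply: bigcup_open => v _; exact: cylinder_open.
Qed.

Variable Om : int -> set (set A).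
Hypothesis Om_fin : forall j, finite_set (Om j).
Definition path_space : set (paths A) := [set w | forall j, Om j (w j)].
Local Notation Omg := path_space.

(** A path outside the product is detected by one coordinate, so the complement is
    open. *)
Lemma path_space_measurable : measurable Omg.
Proof.
rewrite -[Omg]setCK; apply: measurableC; apply: seq_open_measurable.
have -> : ~` Omg = \bigcup_(j in setT) [set w : paths A | (~` Om j) (w j)].
  apply/seteqP; split=> w; first by move/existsNP => [j wj]; exists j.
  by move=> [j _ wj] /(_ j).
by apply: bigcup_open => j _; exact: coordinate_open.
Qed.

Definition update v (j : int) (o : set A) : paths A := fun i => if i == j then o else v i.

Lemma update_path_space v j o : Omg v -> Om j o -> Omg (update v j o).
Proof. by move=> vO oO i; rewrite /update; case: eqP => // ->. Qed.

Lemma cylinder_update v k m o : cylinder (update v (k + m%:Z) o) k m.+1 =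
  cylinder v k m `&` [set w | w (k + m%:Z) = o].
Proof.
apply/seteqP; split=> w.
  move=> h; split=> [j jk|/=].
    by rewrite h; [rewrite /update ifF//|]; lia.
  by rewrite h; [rewrite /update eqxx|lia].
move=> [h1 h2] j jk; rewrite /update; case: eqP => [->//|jm].
by apply: h1; lia.
Qed.

Variable mu : probability (paths A) R.

Lemma local_measurable (f : paths A -> R) k m :
  (forall v w, cylinder v k m w -> f w = f v) -> measurable_fun setT f.
Proof.
move=> floc _ Y _; rewrite setTI; apply: seq_open_measurable.
by apply: (@local_open _ k m) => v w Yv /floc; rewrite /= => ->.
Qed.

(** [g i v] is the integral over the paths which agree with [v] on the first [i]
    coordinates.  When all the relevant coordinates are fixed the integrand is
    constant; freeing a coordinate splits the integral into a finite sum. *)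
Lemma integral_local (f : paths A -> R) (q : paths A -> R) (g : nat -> paths A -> R) k m :
  (forall v w, cylinder v k m w -> f w = f v) ->
  (forall v, Omg v -> mu (Omg `&` cylinder v k m) = (q v)%:E) ->
  (forall v, Omg v -> f v * q v = g m v) ->
  (forall v i, (i < m)%N -> Omg v ->
     g i v = \sum_(o <- fset_set (Om (k + i%:Z))) g i.+1 (update v (k + i%:Z) o)) ->
  forall v, Omg v -> (\int[mu]_(w in Omg) (f w)%:E = (g 0%N v)%:E)%E.
Proof.
move=> floc muq fq gS v vO.
have mf := local_measurable floc.
have mc u i : measurable (Omg `&` cylinder u k i).
  apply: measurableI; first exact: path_space_measurable.
  by apply: seq_open_measurable; exact: cylinder_open.
suff int i u : (i <= m)%N -> Omg u ->
    (\int[mu]_(w in Omg `&` cylinder u k (m - i)) (f w)%:E = (g (m - i)%N u)%:E)%E.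
  have := int m v (leqnn m) vO; rewrite subnn.
  suff -> : Omg `&` cylinder v k 0 = Omg by [].
  by apply/seteqP; split=> [w []//|w wO]; split=> // j; lia.
elim: i u => [|i IH] u im uO.
  rewrite subn0 (eq_integral (cst (f u)%:E)); last first.
    by move=> w; rewrite inE => -[_ /floc ->].
  rewrite integral_cst//; apply: etrans (congr1 (mule (f u)%:E) (muq u uO)) _.
  by rewrite -EFinM fq.
set p := (m - i.+1)%N; have pm : (p < m)%N by rewrite /p; lia.
have pS : (m - i)%N = p.+1 by rewrite /p; lia.
rewrite pS in IH.
pose C o := Omg `&` cylinder (update u (k + p%:Z) o) k p.+1.
have CE : Omg `&` cylinder u k p = \big[setU/set0]_(o <- fset_set (Om (k + p%:Z))) C o.
  rewrite -bigcup_seq; apply/seteqP; split=> w.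
    move=> [wO uw]; exists (w (k + p%:Z)); first by rewrite /= in_fset_set ?inE.
    by split=> //; rewrite cylinder_update.
  case=> a; rewrite /= in_fset_set // inE => aO [wO].
  by rewrite cylinder_update => -[].
rewrite CE integral_bigsetU_EFin//=; first last.
- by apply/measurable_EFinP; apply: measurable_funS mf.
- move=> o o' _ _ [w [[_ +] [_]]]; rewrite !cylinder_update => -[_ /= <-].
  by move=> -[_ /= <-].
- by move=> o; exact: mc.
rewrite gS// -sumEFin big_seq [RHS]big_seq; apply: eq_bigr => o.
rewrite in_fset_set// inE => oO; apply: IH; first exact: ltnW.
exact: update_path_space.
Qed.

End PathSpace.

(** * Transition expectations *)

Section Sites.
Variables (R : realType) (A : cstarType R) (F : fermion A).
Local Notation I := (sites F).

Lemma sites_convex (k j n : int) : k \in I -> n \in I -> k <= j <= n -> j \in I.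
Proof.
case: (sites F) => a b; rewrite !itv_boundlr => /andP[ak _] /andP[_ nb] /andP[kj jn].
by apply/andP; split; [apply: le_trans ak _|apply: le_trans nb]; rewrite bnd_simp.
Qed.

Lemma mem_seg (k n j : int) : k <= n -> (j \in seg k n) = (k <= j <= n).
Proof.
move=> kn; apply/imfsetP/idP => [[h]|kjn].
  by rewrite !inE mem_iota => ? ->; lia.
by exists (absz (j - k)); [rewrite !inE mem_iota|]; lia.
Qed.

Lemma alg_segE (k n : int) : k <= n -> alg_seg F k n = alg F [set` seg k n].
Proof.
move=> kn; congr alg; apply/seteqP; split=> j /=; by rewrite mem_seg.
Qed.

End Sites.

Section Markov.
Variables (R : realType) (A : cstarType R) (F : fermion A).
Variables (phi : A -> R[i]) (E eps calE : int -> A -> A).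
Hypothesis phi_markov : markov_state_with F phi E.
Hypothesis phi_faithful : locally_faithful F phi.
Hypothesis eps_trans : transition_expectations F E eps.
Hypothesis calE_cond : markov_cond_expectations F eps calE.
Local Notation I := (sites F).
Local Notation Theta := (parity F).

Let phi_state : is_state phi. Proof. by case: phi_markov => -[]. Qed.

Lemma faithful_seg k n : k <= n -> faithful_on (alg_seg F k n) phi.
Proof. by move=> kn; rewrite alg_segE//; exact: phi_faithful. Qed.

Section Site.
Variable n : int.
Local Notation L := (alg_seg F n (n + 1)).

Definition fixed_alg : set A := eps n @` L.

Lemma segW : alg_seg F n n `<=` L.
Proof. by apply: alg_sub => j /=; lia. Qed.

Lemma seg_le : L `<=` alg_le F (n + 1).
Proof. by apply: alg_sub => j /=; lia. Qed.

Lemma site_le : alg_seg F n n `<=` alg_le F n.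
Proof. by apply: alg_sub => j /=; lia. Qed.

Hypothesis n_lt : lt_jmax F n.

Let L_alg : cstar_subalg L. Proof. exact: cstar_gen_subalg. Qed.

Let E_lin : linear_on L (E n).
Proof.
case: phi_markov => _ /(_ n n_lt)[[lin _ _ _ _] _ _ _] c x y Lx Ly.
by apply: lin; exact: seg_le.
Qed.

Let E_site x : L x -> alg_seg F n n (E n x).
Proof. by case: phi_markov => _ /(_ n n_lt)[_ _ _]; apply. Qed.

Let E_seg x : L x -> L (E n x).
Proof. by move=> Lx; apply: segW; exact: E_site. Qed.

Let E_cp : cp_on (alg_le F (n + 1)) (alg_le F n) (E n).
Proof. by case: phi_markov => _ /(_ n n_lt)[[]]. Qed.

Let E1 : E n 1 = 1.
Proof. by case: phi_markov => _ /(_ n n_lt)[[]]. Qed.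

Let E_phi x : L x -> phi (E n x) = phi x.
Proof. by case: phi_markov => _ /(_ n n_lt)[_ _ inv _] Lx; apply: inv; exact: seg_le. Qed.

Let L_faithful : faithful_on L phi.
Proof. by apply: faithful_seg; lia. Qed.

Let eps_lim x : L x -> norm_cvg (ergodic_mean (E n) ^~ x) (eps n x).
Proof. exact: eps_trans. Qed.

Lemma E_eps x : L x -> E n (eps n x) = eps n x.
Proof. exact: (f_eps phi_state L_alg seg_le E_lin E_seg E_cp E1 E_phi L_faithful eps_lim).
    Qed.

Lemma eps_seg x : L x -> L (eps n x).
Proof. exact: (epsL L_alg E_seg eps_lim). Qed.

Lemma eps_site x : L x -> alg_seg F n n (eps n x).
Proof. by move=> Lx; rewrite -E_eps//; apply: E_site; exact: eps_seg. Qed.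

Lemma epsD c x y : L x -> L y -> eps n (c *: x + y) = c *: eps n x + eps n y.
Proof. by move=> Lx Ly; apply: (eps_linear L_alg E_lin E_seg eps_lim). Qed.

Lemma eps_adj x : L x -> eps n (star x) = star (eps n x).
Proof. exact: (eps_star L_alg seg_le E_seg E_cp eps_lim). Qed.

Lemma eps_parity x : L x -> eps n (Theta x) = Theta (eps n x).
Proof.
apply: (eps_commute E_seg eps_lim (parity_linear F) (parity_norm F)) => {}x Lx.
  exact: alg_parity.
by case: phi_markov => _ /(_ n n_lt)[_ Eev _ _]; apply: Eev; exact: seg_le.
Qed.

Lemma fixed_algP b : fixed_alg b -> [/\ L b, alg_seg F n n b, E n b = b & eps n b = b].
Proof.
move=> [x Lx <-]; split; [exact: eps_seg|exact: eps_site|exact: E_eps|].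
by apply: (eps_fixed eps_lim); [exact: eps_seg|exact: E_eps].
Qed.

Lemma epsMl b y : fixed_alg b -> L y -> eps n (b * y) = b * eps n y.
Proof.
move=> /fixed_algP[Lb _ Eb _] Ly.
exact: (eps_mull phi_state L_alg seg_le E_seg E_cp E1 E_phi L_faithful eps_lim).
Qed.

Lemma epsMr b y : fixed_alg b -> L y -> eps n (y * b) = eps n y * b.
Proof.
move=> /fixed_algP[Lb _ Eb _] Ly.
exact: (eps_mulr phi_state L_alg seg_le E_seg E_cp E1 E_phi L_faithful eps_lim).
Qed.

Let aL : star_subalg L := cstar_star_subalg L_alg.

Lemma eps_fixed_alg x : L x -> fixed_alg (eps n x).
Proof. by exists x. Qed.

Lemma eps1 : eps n 1 = 1.
Proof. by apply: (eps_fixed eps_lim) => //; exact: (subalg1 aL). Qed.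

Lemma fixed_alg_alg : star_subalg fixed_alg.
Proof.
split.
- by exists 1; [exact: (subalg1 aL)|exact: eps1].
- move=> c x y fx fy; have [[Lx _ _ ex] [Ly _ _ ey]] := (fixed_algP fx, fixed_algP fy).
  exists (c *: x + y); last by rewrite epsD// ex ey.
  by apply: (subalgD aL) => //; exact: (subalgZ aL).
- move=> x y fx fy; have [[Lx _ _ ex] [Ly _ _ ey]] := (fixed_algP fx, fixed_algP fy).
  by exists (x * y); [exact: (subalgM aL)|rewrite epsMl// ey].
- move=> x fx; have [Lx _ _ ex] := fixed_algP fx.
  by exists (star x); [exact: (subalg_star aL)|rewrite eps_adj// ex].
Qed.

Lemma fixed_alg_parity x : fixed_alg x -> fixed_alg (Theta x).
Proof.
move=> fx; have [Lx _ _ ex] := fixed_algP fx.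
by exists (Theta x); [exact: alg_parity|rewrite eps_parity// ex].
Qed.

(** The quasi-conditional expectation is a module map over the sites before [n] and
    preserves the state; so the iterates, and their averages, preserve [phi (x y)]. *)
Lemma phi_eps x y : alg_le F (n - 1) x -> L y -> phi (x * eps n y) = phi (x * y).
Proof.
move=> xn Ly; apply: (eps_invariant phi_state eps_lim) => // h.
case: phi_markov => _ /(_ n n_lt)[[_ _ _ _ EM] _ inv _].
have len x' : alg_le F (n - 1) x' -> alg_le F (n + 1) x' by apply: alg_sub => j /=; lia.
have xE z : L z -> phi (x * E n z) = phi (x * z).
  move=> Lz; rewrite -EM//; last exact: seg_le.
  by apply: inv; apply: (subalgM (algA F _)); [exact: len|exact: seg_le].
elim: h => //= h <-; apply: xE.
exact: (iterL E_seg).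
Qed.

Lemma calEM x y : alg_le F (n - 1) x -> L y -> calE n (x * y) = x * eps n y.
Proof. by case: (calE_cond n_lt) => _ _; apply. Qed.

Lemma calE_le x : alg_le F (n + 1) x -> alg_le F n (calE n x).
Proof. by case: (calE_cond n_lt) => _ + _; apply. Qed.

(** By [phi_eps] this holds for the products that determine [calE n], and both sides
    are continuous. *)
Lemma phi_calE x : alg_le F (n + 1) x -> phi (calE n x) = phi x.
Proof.
have [clin _ _ _ cle] : cond_expectation (alg_le F (n + 1)) (calE n)
    by case: (calE_cond n_lt).
have aD := algA F [set j | j <= n + 1].
move: x; suff sub : alg_le F (n + 1) `<=` [set x | alg_le F (n + 1) x /\
    phi (calE n x) = phi x].
  by move=> x /sub[].
apply: alg_le_ind.
- move=> u z uP uz; have Dz : alg_le F (n + 1) z.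
    by apply: (alg_closed _ uz) => k; case: (uP k).
  have c0 : calE n 0 = 0.
    have := clin 1 0 0 (subalg0 aD) (subalg0 aD).
    by rewrite !scale1r addr0 -{1}[calE n 0]addr0 => /addrI.
  have cB k : calE n (u k) - calE n z = calE n (u k - z).
    have Du : alg_le F (n + 1) (u k) by case: (uP k).
    by have := clin (-1) _ _ Dz Du; rewrite !scaleN1r addrC [calE n (u k) - _]addrC => <-;
        rewrite addrC.
  have cuz : norm_cvg (calE n \o u) (calE n z).
    apply: (@norm_cvg_le _ _ _ _ (fun k => cnorm (u k - z))) => // k /=.
    by rewrite cB; apply: cle; apply: (subalgB aD) => //; case: (uP k).
  split=> //; apply/eqP; rewrite -subr_eq0 -stateB//; apply/eqP.
  apply: (state_cvg_unique phi_state (norm_cvgB cuz uz)) => k.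
  by rewrite stateB//=; case: (uP k) => _ ->; rewrite subrr.
- split=> [|c y z [Dy py] [Dz pz]].
    have c0 : calE n 0 = 0.
      have := clin 1 0 0 (subalg0 aD) (subalg0 aD).
      by rewrite !scale1r addr0 -{1}[calE n 0]addr0 => /addrI.
    by rewrite /= c0; split=> //; exact: (subalg0 aD).
  split; first by apply: (subalgD aD) => //; exact: (subalgZ aD).
  by rewrite clin// !(stateD, stateZ)// py pz.
- move=> x y xn Ly; split; last by rewrite calEM// phi_eps.
  apply: (subalgM aD); last exact: seg_le.
  by apply: alg_sub xn => j /=; lia.
Qed.

Lemma center_alg : star_subalg (center_of fixed_alg).
Proof.
have aR := fixed_alg_alg; split.
- by split=> [|y _]; [exact: (subalg1 aR)|rewrite mulr1 mul1r].
- move=> c x y [Rx xc] [Ry yc]; split=> [|z Rz].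
    by apply: (subalgD aR) => //; exact: (subalgZ aR).
  by rewrite mulrDl mulrDr -scalerAl -scalerAr xc// yc.
- move=> x y [Rx xc] [Ry yc]; split=> [|z Rz]; first exact: (subalgM aR).
  by rewrite -mulrA yc// mulrA xc// mulrA.
- move=> x [Rx xc]; split=> [|z Rz]; first exact: (subalg_star aR).
  by rewrite -[z]starK -!starM xc//; exact: (subalg_star aR).
Qed.

Lemma center_parity z : center_of fixed_alg z -> center_of fixed_alg (Theta z).
Proof.
move=> [Rz zc]; split=> [|y Ry]; first exact: fixed_alg_parity.
by rewrite -[y](parityK F) -!parity_mul zc//; exact: fixed_alg_parity.
Qed.

End Site.

(** At the site [n + 1] both sides reduce to [phi (x q (eps y))], because [q] is
    central.  For later sites the last factor is integrated out, which moves the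
    problem one site to the left. *)
Lemma phi_center_commute n q (m : nat) x : lt_jmax F n ->
  center_of (fixed_alg n) q -> Theta q = q ->
  n + 1 + m%:Z \in I -> alg_le F (n + 1 + m%:Z) x -> phi (q * x) = phi (x * q).
Proof.
move=> n_lt [Rq qc] qe; have [Lq qn _ _] := fixed_algP n_lt Rq.
have cvgl u z : norm_cvg u z -> norm_cvg (fun k => q * u k - u k * q) (q * z - z * q).
  by move=> uz; apply: norm_cvgB; apply: norm_cvgM => //; exact: norm_cvg_cst.
have closedP : norm_closed [set x | phi (q * x) = phi (x * q)].
  move=> u z uP uz; apply/eqP; rewrite -subr_eq0 -stateB//; apply/eqP.
  by apply: (state_cvg_unique phi_state (cvgl _ _ uz)) => k; rewrite stateB// uP subrr.
have subP : lin_subspace [set x | phi (q * x) = phi (x * q)].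
  split=> [|c y z ey ez] /=; first by rewrite mulr0 mul0r.
  by rewrite mulrDr mulrDl -scalerAr -scalerAl !(stateD, stateZ)// ey ez.
have nI : n \in I by case/andP: n_lt.
elim: m x => [|m IHm] x mI.
  rewrite addr0; apply: (alg_le_ind closedP subP) => {}x y xn Ly.
  have aL := algA F [set j | n <= j <= n + 1].
  have qx : x * q = q * x.
    by apply: (even_commute _ xn qn qe) => j _ /=; lia.
  rewrite /= mulrA -qx -[x * q * y]mulrA -(phi_eps n_lt xn (subalgM aL Lq Ly)) epsMl//.
  rewrite -[x * y * q]mulrA -(phi_eps n_lt xn (subalgM aL Ly Lq)) epsMr//.
  by rewrite qc//; exact: eps_fixed_alg.
set p := n + 1 + m%:Z; have pE : n + 1 + m.+1%:Z = p + 1 by rewrite /p; lia.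
rewrite pE in mI *.
have pI : p \in I by apply: sites_convex nI mI _; rewrite /p; lia.
have p_lt : lt_jmax F p by rewrite /lt_jmax pI.
have ap := algA F [set j | j <= p - 1].
apply: (alg_le_ind closedP subP) => {}x y xp Ly; rewrite /= mulrA.
have qp : alg_le F (p - 1) q by apply: alg_sub qn => j /=; rewrite /p; lia.
have comm S z : (forall j, S j -> p <= j) -> alg F S z -> z * q = q * z.
  move=> Sp Sz; apply: (even_commute _ Sz qn qe) => j _ /Sp /=; rewrite /p; lia.
(* Replace y by eps p y on the left, apply the induction hypothesis at the
   site p, and put y back on the right. *)
rewrite -(phi_eps p_lt (subalgM ap qp xp) Ly) -mulrA IHm//; last first.
  apply: (subalgM (algA F _)); first by apply: alg_sub xp => j /=; lia.
  exact: (site_le (eps_site p_lt Ly)).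
rewrite -[in LHS]mulrA (comm _ _ _ (eps_site p_lt Ly)); last by move=> j /=; lia.
rewrite -[in RHS]mulrA (comm _ _ _ Ly); last by move=> j /=; lia.
by rewrite !mulrA -(phi_eps p_lt (subalgM ap xp qp) Ly).
Qed.

(** * The projections of the orbits *)

Local Notation Z n := (center_of (fixed_alg n)).
Local Notation Q := (@Qproj R A).

Lemma center_site j : lt_jmax F j -> Z j `<=` alg_seg F j j.
Proof. by move=> j_lt z [/(fixed_algP j_lt)[]]. Qed.

Lemma center_comm j x y : Z j x -> Z j y -> x * y = y * x.
Proof. by move=> [_ xc] [Ry _]; exact: xc. Qed.

Lemma center_dependent j : lt_jmax F j -> fin_dependent (Z j).
Proof.
move=> j_lt; apply: (fin_dependent_sub (center_site j_lt)).
apply: fin_spanned_dependent; apply: (fin_spanned_site phi_state).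
  by case/andP: j_lt.
exact: faithful_seg.
Qed.

Lemma central_atom_parity j p : lt_jmax F j ->
  central_atoms F eps j p -> central_atoms F eps j (Theta p).
Proof.
move=> j_lt [Zp [ps pp] pn0 pmin]; split.
- exact: (center_parity j_lt).
- by split; [rewrite -parity_star ps|rewrite -parity_mul pp].
- by apply: contra_neq pn0 => p0; rewrite -(parityK F p) p0 parity0.
- move=> q Zq [qs qq] qp.
  have [] := pmin (Theta q) (center_parity j_lt Zq).
  + by split; [rewrite -parity_star qs|rewrite -parity_mul qq].
  + by rewrite -[p](parityK F) -parity_mul qp.
  + by move=> q0; left; rewrite -(parityK F q) q0 parity0.
  + by move=> <-; right; rewrite parityK.
Qed.

(** An orbit of the parity may consist of a single projection. *)
Lemma Qproj_pair (p q : A) : Q [set p; q] = if p == q then p else p + q.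
Proof.
rewrite /Qproj; case: eqP => [->|pq]; first by rewrite setUid fsbig_set1.
rewrite fsbigU0 ?fsbig_set1//; try exact: finite_set1.
by move=> x [/= -> /pq].
Qed.

Lemma Qproj1 : Q [set 1] = 1.
Proof. by rewrite /Qproj fsbig_set1. Qed.

Lemma Omega_lt j o : lt_jmax F j -> Omega_ F eps j o ->
  exists2 p, central_atoms F eps j p & o = [set p; Theta p].
Proof. by rewrite /Omega_ => -> [p pa <-]; exists p. Qed.

Lemma Omega_last j o : ~~ lt_jmax F j -> Omega_ F eps j o -> o = [set 1].
Proof. by rewrite /Omega_ => /negPf ->. Qed.

Lemma Omega_finite j : finite_set (Omega_ F eps j).
Proof.
rewrite /Omega_; case: ifP => [j_lt|_]; last exact: finite_set1.
apply: finite_image; apply: minimal_projection_finite.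
- exact: center_alg.
- exact: center_comm.
- exact: center_dependent.
Qed.

Lemma atom_orth j p q : lt_jmax F j -> central_atoms F eps j p ->
  central_atoms F eps j q -> p != q -> p * q = 0.
Proof.
by move=> j_lt; apply: minimal_projection_orthogonal;
  [exact: center_alg|exact: center_comm].
Qed.

Lemma Qproj_center j o : lt_jmax F j -> Omega_ F eps j o -> Z j (Q o).
Proof.
move=> j_lt /(Omega_lt j_lt)[p pa ->]; rewrite Qproj_pair.
have [Zp _ _ _] := pa; case: ifP => // _.
by apply: (subalgD (center_alg j_lt)) => //; exact: center_parity.
Qed.

Lemma Qproj_site j o : Omega_ F eps j o -> alg_seg F j j (Q o).
Proof.
move=> oO; have [j_lt|j_lt] := boolP (lt_jmax F j).
  by apply: (center_site j_lt); exact: Qproj_center.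
by rewrite (Omega_last j_lt oO) Qproj1; exact: (subalg1 (algA F _)).
Qed.

Lemma Qproj_even j o : Omega_ F eps j o -> Theta (Q o) = Q o.
Proof.
move=> oO; have [j_lt|j_lt] := boolP (lt_jmax F j); last first.
  by rewrite (Omega_last j_lt oO) Qproj1 parity1.
have [p pa ->] := Omega_lt j_lt oO; rewrite Qproj_pair.
by case: eqP => [<-//|_]; rewrite parityD parityK addrC.
Qed.

Lemma Qproj_proj j o : Omega_ F eps j o -> star (Q o) = Q o /\ Q o * Q o = Q o.
Proof.
move=> oO; have [j_lt|j_lt] := boolP (lt_jmax F j); last first.
  by rewrite (Omega_last j_lt oO) Qproj1 star1 mulr1.
have [p pa ->] := Omega_lt j_lt oO; rewrite Qproj_pair.
have [_ [ps pp] _ _] := pa; have [_ [ps' pp'] _ _] := central_atom_parity j_lt pa.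
case: eqP => // /eqP pT; split; first by rewrite starD ps ps'.
rewrite mulrDl !mulrDr pp pp' (atom_orth j_lt)//; last exact: central_atom_parity.
rewrite (atom_orth j_lt _ pa) ?addr0 ?add0r//; last by rewrite eq_sym.
exact: central_atom_parity.
Qed.

Lemma Qproj_orth j o o' : Omega_ F eps j o -> Omega_ F eps j o' -> o != o' -> Q o * Q o' = 0.
Proof.
move=> oO oO'; have [j_lt|j_lt] := boolP (lt_jmax F j); last first.
  by rewrite (Omega_last j_lt oO) (Omega_last j_lt oO') eqxx.
have [p pa ->] := Omega_lt j_lt oO; have [q qa ->] := Omega_lt j_lt oO'.
have [pa' qa'] := (central_atom_parity j_lt pa, central_atom_parity j_lt qa).
move=> neq.
have n1 : p != q by apply: contra_neq neq => ->.
have n2 : p != Theta q.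
  by apply: contra_neq neq => ->; rewrite parityK setUC.
have n3 : Theta p != q.
  by apply: contra_neq neq => <-; rewrite parityK setUC.
have n4 : Theta p != Theta q by rewrite (inj_eq (inv_inj (parityK F))).
rewrite !Qproj_pair; case: ifP => _; case: ifP => _; rewrite ?mulrDl ?mulrDr;
  by rewrite !(atom_orth j_lt)// ?addr0.
Qed.

Lemma Qproj_neq0 j o : Omega_ F eps j o -> Q o != 0.
Proof.
move=> oO; have [j_lt|j_lt] := boolP (lt_jmax F j); last first.
  by rewrite (Omega_last j_lt oO) Qproj1 oner_eq0.
have [p pa ->] := Omega_lt j_lt oO; rewrite Qproj_pair.
have [_ [ps pp] pn0 _] := pa; have pa' := central_atom_parity j_lt pa.
case: (p =P Theta p) => // /eqP pT; apply: contra_neq pn0 => h.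
by rewrite -(mulr0 p) -h mulrDr pp (atom_orth j_lt)// addr0.
Qed.

Lemma phi_Qproj_neq0 j o : Omega_ F eps j o -> phi (Q o) != 0.
Proof.
move=> oO; have [qs qq] := Qproj_proj oO.
apply: contra_neq (Qproj_neq0 oO) => q0.
have jj : j <= j by [].
by apply: (faithful_seg jj (Qproj_site oO)); rewrite qs qq.
Qed.

(** The eigenvalue on [p] is also the eigenvalue on its image under the parity, as [z]
    is even. *)
Lemma Qproj_eigen j o z : lt_jmax F j -> Omega_ F eps j o -> Z j z ->
  star z = z -> Theta z = z -> exists c : R[i], z * Q o = c *: Q o.
Proof.
move=> j_lt oO Zz zs ze; have [p pa ->] := Omega_lt j_lt oO.
have [c zp] : exists c : R[i], z * p = c *: p.
  apply: (minimal_projection_eigen (center_alg j_lt)) => //; first exact: center_comm.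
  exact: center_dependent.
exists c; rewrite Qproj_pair; case: ifP => // _.
rewrite mulrDr scalerDr zp; congr (_ + _).
by rewrite -{1}ze -parity_mul zp parityZ.
Qed.

(** [Q o'] is even and lives on the next site, so it commutes with the range of [eps j]
    and [eps j (Q o')] is central.  On [Q o] it is a scalar, which is the transition
    probability since both sides have the same value under [phi]. *)
Lemma eps_Qproj j o o' : lt_jmax F j -> Omega_ F eps j o -> Omega_ F eps (j + 1) o' ->
  eps j (Q o * Q o') = transition phi eps j o o' *: Q o.
Proof.
move=> j_lt oO oO'.
have [Ro oc] := Qproj_center j_lt oO.
have L' : alg_seg F j (j + 1) (Q o').
  by apply: alg_sub (Qproj_site oO') => k /=; lia.
have e1 : eps j (Q o * Q o') = eps j (Q o') * Q o.
  rewrite epsMl// oc//; exact: eps_fixed_alg.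
have [|||c ec] := Qproj_eigen (z := eps j (Q o')) j_lt oO.
- split=> [|y Ry]; first exact: eps_fixed_alg.
  have [_ yj _ _] := fixed_algP j_lt Ry.
  rewrite -epsMl// -epsMr//; congr (eps j _); apply/esym.
  by apply: (even_commute _ yj (Qproj_site oO') (Qproj_even oO')) => k _ /=; lia.
- by rewrite -eps_adj//; case: (Qproj_proj oO') => ->.
- by rewrite -eps_parity// (Qproj_even oO').
rewrite /transition e1 ec stateZ// mulfK//; exact: phi_Qproj_neq0 oO.
Qed.

(** * The Markov property *)

Definition Qlist (w : paths A) (s : seq int) : A := \prod_(j <- s) Q (w j).

Definition int_seq (k : int) (m : nat) : seq int := [seq k + i%:Z | i <- iota 0 m].

Lemma int_seqS k m : int_seq k m.+1 = rcons (int_seq k m) (k + m%:Z).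
Proof. by rewrite /int_seq -addn1 iotaD map_cat cats1. Qed.

Lemma mem_int_seq k m j : (j \in int_seq k m) = (k <= j < k + m%:Z).
Proof.
apply/mapP/idP => [[h]|jk]; first by rewrite mem_iota => ? ->; lia.
by exists (absz (j - k)); [rewrite mem_iota|]; lia.
Qed.

Lemma int_seq_uniq k m : uniq (int_seq k m).
Proof. by rewrite map_inj_uniq ?iota_uniq// => i j; lia. Qed.

Lemma prod_commute (T : eqType) (f : T -> A) (x : A) (s : seq T) :
  (forall j, j \in s -> f j * x = x * f j) ->
      (\prod_(j <- s) f j) * x = x * \prod_(j <- s) f j.
Proof.
elim: s => [|j s IH] fx; first by rewrite big_nil mul1r mulr1.
rewrite big_cons -mulrA IH ?mulrA ?fx ?mem_head// => i si.
by apply: fx; rewrite inE si orbT.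
Qed.

Lemma prod_perm (T : eqType) (f : T -> A) (s t : seq T) :
  (forall i j, f i * f j = f j * f i) -> perm_eq s t ->
  \prod_(j <- s) f j = \prod_(j <- t) f j.
Proof.
move=> fc; elim: s t => [|j s IH] t.
  by rewrite perm_sym => /perm_nilP ->.
move=> st; have jt : j \in t by rewrite -(perm_mem st) mem_head.
have [t1 [t2 te]] : exists t1 t2, t = t1 ++ j :: t2.
  by move: jt => /splitPr[t1 t2]; exists t1, t2.
move: st; rewrite te => st.
rewrite big_cat !big_cons /= mulrA (prod_commute (x := f j))// -mulrA -big_cat.
congr (_ * _); apply: IH; rewrite -(perm_cons j); apply: perm_trans st _.
by rewrite -cat1s perm_catCA.
Qed.

Section Path.
Variable w : paths A.
Hypothesis wO : Omega F eps w.

Lemma label_commute i j : Q (w i) * Q (w j) = Q (w j) * Q (w i).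
Proof.
have [->//|ij] := eqVneq i j.
apply: (even_commute _ (Qproj_site (wO i)) (Qproj_site (wO j)) (Qproj_even (wO j))).
by move=> k _ /= ki kj; apply: (negP ij); apply/eqP; lia.
Qed.

Lemma Qlist_perm s t : perm_eq s t -> Qlist w s = Qlist w t.
Proof. exact/prod_perm/label_commute. Qed.

Lemma Qlist_proj s : star (Qlist w s) = Qlist w s /\ Qlist w s * Qlist w s = Qlist w s.
Proof.
elim: s => [|j s [IHs IHp]]; first by rewrite /Qlist big_nil star1 mulr1.
have [js jj] := Qproj_proj (wO j).
have c : Qlist w s * Q (w j) = Q (w j) * Qlist w s.
  by apply: prod_commute => i _; exact: label_commute.
rewrite /Qlist big_cons -/(Qlist w s); split; first by rewrite starM IHs js c.
by rewrite mulrA -[_ * Qlist w s * _]mulrA c mulrA jj -mulrA IHp.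
Qed.

Lemma Qlist_even s : Theta (Qlist w s) = Qlist w s.
Proof.
rewrite /Qlist; elim: s => [|j s IH]; first by rewrite big_nil parity1.
by rewrite big_cons parity_mul IH (Qproj_even (wO j)).
Qed.

Lemma Qlist_alg s (S : set int) : (forall j, j \in s -> S j) -> alg F S (Qlist w s).
Proof.
have aS := algA F S; rewrite /Qlist; elim: s => [|j s IH] sS.
  by rewrite big_nil; exact: (subalg1 aS).
rewrite big_cons; apply: (subalgM aS).
  apply: alg_sub (Qproj_site (wO j)) => i /= ij; have -> : i = j by lia.
  by apply: sS; rewrite mem_head.
by apply: IH => i si; apply: sS; rewrite inE si orbT.
Qed.

Lemma Qlist_commute s (S : set int) x : (forall j, j \in s -> ~ S j) ->
  alg F S x -> Qlist w s * x = x * Qlist w s.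
Proof.
move=> sS Sx; apply/esym.
apply: (even_commute (T := [set j | j \in s]) _ Sx _ (Qlist_even s)).
  by move=> j _ Sj /sS.
exact: Qlist_alg.
Qed.

End Path.

(** The mass which the law of the Markov process gives to the cylinder of [w] over
    the sites from [k] to [k + m]. *)
Definition path_weight (w : paths A) (k : int) (m : nat) : R[i] :=
  marginal phi (w k) *
  \prod_(i < m) transition phi eps (k + i%:Z) (w (k + i%:Z)) (w (k + i%:Z + 1)).

Lemma sites_lt k m : k \in I -> k + m.+1%:Z \in I -> lt_jmax F (k + m%:Z).
Proof.
move=> kI nI; rewrite /lt_jmax (sites_convex kI nI) ?(sites_convex kI nI)//; lia.
Qed.

(** The last projection is integrated out by the transition expectation, which
    contributes one transition probability. *)
Lemma phi_Qlist w k m : Omega F eps w -> k \in I -> k + m%:Z \in I ->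
  phi (Qlist w (int_seq k m.+1)) = path_weight w k m.
Proof.
move=> wO kI; elim: m => [|m IH] nI.
  by rewrite /Qlist /path_weight big_ord0 mulr1 big_seq1 addr0.
have p_lt := sites_lt kI nI.
have pI : k + m%:Z \in I by case/andP: p_lt.
have QS s j : Qlist w (rcons s j) = Qlist w s * Q (w j)
    by rewrite /Qlist -cats1 big_cat big_seq1.
rewrite /path_weight big_ord_recr /= mulrA -/(path_weight w k m) -IH//.
set p := k + m%:Z in p_lt pI *; have pE : k + m.+1%:Z = p + 1 by rewrite /p; lia.
rewrite !int_seqS !QS -/p pE.
have Lp i : p <= i <= p + 1 -> alg_seg F p (p + 1) (Q (w i)).
  by move=> pi; apply: alg_sub (Qproj_site (wO i)) => j /=; lia.
have aL := algA F [set j | p <= j <= p + 1].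
have ksp : alg_le F (p - 1) (Qlist w (int_seq k m)).
  by apply: (Qlist_alg wO) => j; rewrite mem_int_seq /= /p; lia.
have pp : p <= p <= p + 1 by lia.
have pp1 : p <= p + 1 <= p + 1 by lia.
rewrite -mulrA -(phi_eps p_lt ksp (subalgM aL (Lp _ pp) (Lp _ pp1))).
by rewrite (eps_Qproj p_lt (wO p) (wO (p + 1))) -scalerAr stateZ// mulrC.
Qed.

Lemma path_weight_real w k m : Omega F eps w -> k \in I -> k + m%:Z \in I ->
  path_weight w k m = (complex.Re (path_weight w k m))%:C.
Proof.
move=> wO kI nI; rewrite -phi_Qlist//; apply/esym; apply: RRe_real.
by apply: (state_real phi_state); case: (Qlist_proj wO (int_seq k m.+1)).
Qed.

(** Each step preserves [phi] up to its normalization.  If a transition probability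
    vanishes, both sides are 0 by the convention on inverses. *)
Lemma phi_fibre_comp w k m b : k \in I -> k + m%:Z \in I -> alg_le F (k + m%:Z) b ->
  phi (fibre_comp phi eps calE w k m b) = phi b /
    \prod_(i < m) transition phi eps (k + i%:Z) (w (k + i%:Z)) (w (k + i%:Z + 1)).
Proof.
move=> kI; elim: m b => [|m IH] b nI nb; first by rewrite big_ord0 divr1.
have p_lt := sites_lt kI nI.
have pI : k + m%:Z \in I by case/andP: p_lt.
rewrite big_ord_recr /= /fibre_exp.
set p := k + m%:Z in p_lt pI *; have pE : k + m.+1%:Z = p + 1 by rewrite /p; lia.
rewrite pE in nb; have pb := calE_le p_lt nb.
rewrite IH//; last exact: (subalgZ (algA F [set j | j <= p])).
rewrite stateZ// (phi_calE p_lt nb).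
move: (\prod_(_ < m) _) (transition _ _ _ _ _) (phi b) => P t z.
by rewrite invfM mulrAC mulrC [t^-1 * _]mulrC.
Qed.

Lemma local_psiE w k m b : k \in I -> k + m%:Z \in I -> alg_le F (k + m%:Z) b ->
  local_psi phi eps calE w k (k + m%:Z) b = phi b / path_weight w k m.
Proof.
move=> kI nI nb; rewrite /local_psi; have -> : absz (k + m%:Z - k)%R = m by lia.
by rewrite phi_fibre_comp// /path_weight invfM mulrAC mulrA.
Qed.

Section PathMeasure.
Variable mu : probability (paths A) R.
Hypothesis mu_law : markov_law F phi eps mu.

Lemma mu_cylinder w k m : Omega F eps w -> k \in I -> k + m%:Z \in I ->
  mu (Omega F eps `&` cylinder w k m.+1) = (complex.Re (path_weight w k m))%:E.
Proof.
move=> wO kI nI; have [_ /(_ w k (k + m%:Z) wO kI nI)] := mu_law.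
have -> : absz (k + m%:Z - k)%R = m by lia.
rewrite -/(path_weight w k m) => <-; last by lia.
congr (mu (_ `&` _)); apply/seteqP; split=> v h j jk; apply: h; lia.
Qed.

Lemma Omega_nonempty : exists w, Omega F eps w.
Proof.
have [mu1 _] := mu_law; apply/set0P/eqP => O0.
by move: mu1; rewrite O0 measure0 => /esym/eqP; rewrite onee_eq0.
Qed.

(** The one-site cylinders exhaust the path space, so their masses [phi (Q o)] add up
    to 1.  The projection complementary to the [Q o] thus has state 0, and it
    vanishes because the state is faithful on the algebra of the site. *)
Lemma sum_Qproj j : j \in I -> \sum_(o <- fset_set (Omega_ F eps j)) Q o = 1.
Proof.
move=> jI; have [j_lt|j_lt] := boolP (lt_jmax F j); last first.
  by rewrite /Omega_ (negPf j_lt) fset_set1 big_seq_fset1 Qproj1.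
pose s := fset_set (Omega_ F eps j).
have sO a : a \in s -> Omega_ F eps j a.
  by rewrite in_fset_set ?inE//; exact: Omega_finite.
have [w wO] := Omega_nonempty.
(* The total mass, as an integral over the single coordinate j. *)
have total : complex.Re (phi (\sum_(o <- s) Q o)) = 1.
  have mO : measurable (Omega F eps) by exact: (path_space_measurable (Omega_ F eps)).
  have int1 : (\int[mu]_(v in Omega F eps) (1 : R)%:E =
      (complex.Re (phi (\sum_(o <- s) Q o)))%:E)%E.
    apply: (integral_local (q := fun v => complex.Re (phi (Q (v j)))) (k := j) (m := 1)
      (g := fun i v => complex.Re (phi (if i is 0%N then \sum_(o <- s) Q o else Q (v j))))
      Omega_finite _ _ _ _ wO) => //.
    - move=> v vO; rewrite mu_cylinder ?addr0//.
      by rewrite /path_weight big_ord0 mulr1.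
    - by move=> v _; rewrite mul1r.
    - move=> v [|//] _ vO; rewrite addr0 state_sum// raddf_sum.
      by apply: eq_bigr => o _; rewrite /update eqxx.
  rewrite integral_cst// in int1; have [mu1 _] := mu_law.
  rewrite /= in mu1; move: int1; rewrite mul1e.
  by move=> /(etrans (esym mu1)) [].
pose p : A := 1 - \sum_(o <- s) Q o.
have aj := algA F [set k | j <= k <= j].
have pj : alg_seg F j j p.
  apply: (subalgB aj); first exact: (subalg1 aj).
  by rewrite big_seq; apply: (subalg_sum aj) => a /sO; exact: Qproj_site.
have sums : star (\sum_(o <- s) Q o) = \sum_(o <- s) Q o.
  by rewrite star_sum big_seq [RHS]big_seq; apply: eq_bigr => a /sO /Qproj_proj[].
have sum2 : (\sum_(o <- s) Q o) * (\sum_(o <- s) Q o) = \sum_(o <- s) Q o.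
  rewrite mulr_suml big_seq [RHS]big_seq; apply: eq_bigr => a sa.
  rewrite mulr_sumr (bigD1_seq a)//= big1_seq ?addr0.
    by case: (Qproj_proj (sO _ sa)).
  move=> b /andP[ba sb]; apply: (Qproj_orth (sO _ sa) (sO _ sb)).
  by rewrite eq_sym.
have ps : star p = p by rewrite starB star1 sums.
have pp : p * p = p by rewrite mulrBl mul1r mulrBr mulr1 sum2 subrr subr0.
suff : p = 0 by move=> /eqP; rewrite subr_eq0 => /eqP.
have jj : j <= j by [].
apply: (faithful_seg jj pj); rewrite ps pp.
have pR : phi p \is Num.real by exact: state_real.
by rewrite -(RRe_real pR) stateB// raddfB /= total state1//= subrr.
Qed.

(** The projections of a site lie in the centralizer of the state and add up to the
    identity. *)
Lemma phi_pinching j n x : j \in I -> n \in I -> j <= n -> alg_le F n x ->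
  phi x = \sum_(o <- fset_set (Omega_ F eps j)) phi (Q o * x * Q o).
Proof.
move=> jI nI jn nx; have [j_lt|j_lt] := boolP (lt_jmax F j); last first.
  by rewrite /Omega_ (negPf j_lt) fset_set1 big_seq_fset1 Qproj1 mulr1 mul1r.
have an := algA F [set i | i <= n].
have Qx o : Omega_ F eps j o -> phi (Q o * x * Q o) = phi (x * Q o).
  move=> oO; have nq : alg_le F n (Q o).
    by apply: alg_sub (Qproj_site oO) => i /=; lia.
  have xq : alg_le F n (x * Q o) by exact: (subalgM an).
  have [_ qq] := Qproj_proj oO.
  have Zq := Qproj_center j_lt oO; have qe := Qproj_even oO.
  rewrite -mulrA; have -> : phi (Q o * (x * Q o)) = phi (x * Q o * Q o).
    have [nj|nj] := eqVneq n j.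
      apply: (@phi_center_commute j (Q o) 0%N _ j_lt Zq qe); rewrite addr0.
        by case/andP: j_lt.
      by apply: alg_sub xq => i /=; lia.
    have nE : n = j + 1 + (absz (n - j - 1)%R)%:Z by move/eqP: nj; lia.
    by apply: (@phi_center_commute j (Q o) (absz (n - j - 1)%R) _ j_lt Zq qe); rewrite -nE.
  by rewrite -mulrA qq.
rewrite big_seq (eq_bigr (fun o => phi (x * Q o))); last first.
  by move=> a; rewrite in_fset_set ?inE; [exact: Qx|exact: Omega_finite].
by rewrite -big_seq -state_sum// -mulr_sumr sum_Qproj// mulr1.
Qed.

(** * Integrals of the local states *)

(** The approximations of the value of the fibre state at the image of [x]. *)
Definition cut_psi (k : int) (m : nat) x (w : paths A) : R[i] :=
  phi (Qlist w (int_seq k m.+1) * x * Qlist w (int_seq k m.+1)) / path_weight w k m.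

Lemma Qlist_cylinder k m v w : cylinder v k m w ->
    Qlist w (int_seq k m) = Qlist v (int_seq k m).
Proof.
move=> vw; rewrite /Qlist big_seq [RHS]big_seq; apply: eq_bigr => j.
by rewrite mem_int_seq => jk; rewrite vw.
Qed.

Lemma path_weight_cylinder k m v w : cylinder v k m.+1 w ->
    path_weight w k m = path_weight v k m.
Proof.
move=> vw; rewrite /path_weight; congr (marginal _ _ * _).
  by apply: vw; lia.
by apply: eq_bigr => -[i im] _ /=; congr transition; apply: vw; lia.
Qed.

Lemma cut_psi_cylinder k m x v w : cylinder v k m.+1 w -> cut_psi k m x w = cut_psi k m x v.
Proof.
by move=> vw; rewrite /cut_psi (Qlist_cylinder vw) (path_weight_cylinder vw).
Qed.

(** By the Markov property the denominator is [phi q], where [q] is the product of the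
    projections, and [phi (q * x * q)] is bounded by [phi q] times the norm of [x]. *)
Lemma cut_psi_le k m x w : Omega F eps w -> k \in I -> k + m%:Z \in I ->
  `|cut_psi k m x w| <= (cnorm x)%:C.
Proof.
move=> wO kI nI; have [qs qq] := Qlist_proj wO (int_seq k m.+1).
rewrite /cut_psi -phi_Qlist//; set q := Qlist _ _ in qs qq *.
have q0 : 0 <= phi q by rewrite -qq -{1}qs; exact: state_ge0.
have [->|qn0] := eqVneq (phi q) 0.
  by rewrite invr0 mulr0 normr0 lecR cnorm_ge0.
have qp : 0 < phi q by rewrite lt_def qn0.
rewrite normrM normfV (ger0_norm q0) ler_pdivrMr//.
by have := state_conj_le phi_state q x; rewrite qs qq.
Qed.

(** The weight vanishes only together with the numerator. *)
Lemma cut_psi_weight k m x w : Omega F eps w -> k \in I -> k + m%:Z \in I ->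
  cut_psi k m x w * path_weight w k m =
  phi (Qlist w (int_seq k m.+1) * x * Qlist w (int_seq k m.+1)).
Proof.
move=> wO kI nI; have [qs qq] := Qlist_proj wO (int_seq k m.+1).
rewrite /cut_psi -phi_Qlist//; set q := Qlist _ _ in qs qq *.
have [q0|qn0] := eqVneq (phi q) 0; last by rewrite divfK.
rewrite q0 mulr0; apply/esym/eqP; rewrite -normr_le0.
by have := state_conj_le phi_state q x; rewrite qs qq q0 mulr0.
Qed.

(** On a cylinder the integrand is constant and its integral is [phi (q * x * q)].
    Freeing the coordinates one after the other undoes the cuts.  The functional
    [c] stands for the real or the imaginary part. *)
Lemma integral_cut_psi (c : R[i] -> R) k m x :
  {morph c : y z / y + z} -> c 0 = 0 -> (forall z (r : R), c (z * r%:C) = c z * r) ->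
  k \in I -> k + m%:Z \in I -> alg_le F (k + m%:Z) x ->
  (\int[mu]_(w in Omega F eps) (c (cut_psi k m x w))%:E = (c (phi x))%:E)%E.
Proof.
move=> cD c0 cZ kI nI nx; have [w wO] := Omega_nonempty.
pose g i v := c (phi (Qlist v (int_seq k i) * x * Qlist v (int_seq k i))).
have -> : c (phi x) = g 0%N w by rewrite /g /Qlist big_nil mul1r mulr1.
apply: (integral_local (q := fun v => complex.Re (path_weight v k m)) (k := k) (m := m.+1)
      (g := g) Omega_finite _ _ _ _ wO).
- by move=> u v /cut_psi_cylinder ->.
- by move=> v vO; exact: mu_cylinder.
- by move=> v vO; rewrite -cZ -path_weight_real// cut_psi_weight.
move=> v i im vO; rewrite /g; set q := Qlist v _.
have kiI : k + i%:Z \in I by apply: sites_convex kI nI _; lia.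
have an := algA F [set j | j <= k + m%:Z].
have nq : alg_le F (k + m%:Z) q.
  by apply: (Qlist_alg vO) => j; rewrite mem_int_seq /=; lia.
have nqxq : alg_le F (k + m%:Z) (q * x * q) by apply: (subalgM an) => //; exact: (subalgM an).
have ki : k + i%:Z <= k + m%:Z by lia.
rewrite (phi_pinching kiI nI ki nqxq) (big_morph c cD c0) big_seq [RHS]big_seq.
apply: eq_bigr => a; rewrite in_fset_set ?inE; last exact: Omega_finite.
move=> aO; set u := update v _ a.
have uO : Omega F eps u by exact: update_path_space.
have uv : Qlist u (int_seq k i) = q.
  apply: Qlist_cylinder => j jk; rewrite /u /update; case: eqP => // jE; lia.
have uk : u (k + i%:Z) = a by rewrite /u /update eqxx.
have uS : Qlist u (int_seq k i.+1) = q * Q a.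
  by rewrite int_seqS /Qlist -cats1 big_cat big_seq1 -/(Qlist u _) uv uk.
have qa : q * Q a = Q a * q.
  rewrite -uv /Qlist; apply: prod_commute => j _; rewrite -uk.
  exact: label_commute.
by rewrite uS {1}qa !mulrA.
Qed.

(** * Passage to the limit *)

(** A sequence of sites which gets below every site, whether or not there is a first
    one. *)
Fixpoint descend (k : int) (i : nat) : int :=
  if i is i'.+1 then
    let k' := descend k i' in if k' - 1 \in I then k' - 1 else k'
  else k.

(** A sequence of sites which gets above every site, whether or not there is a last
    one. *)
Fixpoint ascend (n : int) (i : nat) : int :=
  if i is i'.+1 then
    let n' := ascend n i' in if n' + 1 \in I then n' + 1 else n'
  else n.

Lemma descend_sites k i : k \in I -> descend k i \in I /\ descend k i <= k.
Proof.
move=> kI; elim: i => [|i [iI ik]] /=; first by split.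
by case: ifP => // h; split=> //; lia.
Qed.

Lemma ascend_sites n i : n \in I -> ascend n i \in I /\ n <= ascend n i.
Proof.
move=> nI; elim: i => [|i [iI ni]] /=; first by split.
by case: ifP => // h; split=> //; lia.
Qed.

Lemma descend_le k k0 : k \in I -> k0 \in I -> exists N, forall i, (N <= i)%N ->
    descend k i <= k0.
Proof.
move=> kI k0I; exists (absz (k - k0)%R).
suff h i : descend k i <= k0 \/ descend k i = k - i%:Z by move=> i Ni; case: (h i) => //; lia.
elim: i => [|i IH] /=; first by right; lia.
case: ifP => h; first by case: IH; [left|right]; lia.
case: IH => [|ki]; first by left.
have [ik|ik] := leP (descend k i) k0; first by left.
have [iI _] := descend_sites i kI.
by rewrite (sites_convex k0I iI) in h; last lia.
Qed.

Lemma ascend_le n n0 : n \in I -> n0 \in I -> exists N, forall i, (N <= i)%N ->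
    n0 <= ascend n i.
Proof.
move=> nI n0I; exists (absz (n - n0)%R).
suff h i : n0 <= ascend n i \/ ascend n i = n + i%:Z by move=> i Ni; case: (h i) => //; lia.
elim: i => [|i IH] /=; first by right; lia.
case: ifP => h; first by case: IH; [left|right]; lia.
case: IH => [|ki]; first by left.
have [ik|ik] := leP n0 (ascend n i); first by left.
have [iI _] := ascend_sites i nI.
by rewrite (sites_convex iI n0I) in h; last lia.
Qed.

Lemma Qprod_seg w k m : Omega F eps w ->
  Qprod w (seg k (k + m%:Z)) = Qlist w (int_seq k m.+1).
Proof.
move=> wO; apply: (Qlist_perm wO); apply: uniq_perm; rewrite ?fset_uniq ?int_seq_uniq// => j.
by rewrite mem_int_seq mem_seg; lia.
Qed.

(** The projections outside the region of [x] commute with [x]. *)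
Lemma corner_extend w k0 n0 k m x : Omega F eps w -> k <= k0 -> k0 <= n0 -> n0 <= k + m%:Z ->
  alg_seg F k0 n0 x ->
  Qprod w (seg k0 n0) * x * Qprod w (seg k0 n0)
    * Qprod w (seg k (k + m%:Z) `\` seg k0 n0)%fset
  = Qlist w (int_seq k m.+1) * x * Qlist w (int_seq k m.+1).
Proof.
move=> wO kk0 kn0 n0n xL; rewrite -Qprod_seg//.
set L := seg k0 n0; set L' := seg k _; set D := (L' `\` L)%fset.
have LL' : Qprod w L' = Qprod w L * Qprod w D.
  rewrite /Qprod -big_cat; apply: (Qlist_perm wO); apply: uniq_perm.
  - exact: fset_uniq.
  - rewrite cat_uniq !fset_uniq andbT; apply/hasPn => j /=.
    by rewrite /D in_fsetD => /andP[].
  - move=> j; rewrite mem_cat /D in_fsetD; case: (boolP (j \in L)) => //= jL.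
    by move: jL; rewrite !mem_seg; lia.
have cx : Qprod w D * x = x * Qprod w D.
  apply: (Qlist_commute wO) xL => j; rewrite /D in_fsetD => /andP[+ _] /= jkn.
  by rewrite /L mem_seg// jkn.
have cD : Qprod w D * Qprod w L = Qprod w L * Qprod w D.
  apply: (prod_commute (f := fun j => Q (w j))) => j _; apply/esym.
  apply: (prod_commute (f := fun j => Q (w j))) => i _; exact: label_commute.
have [_ DD] := Qlist_proj wO (enum_fset D); rewrite -/(Qprod w D) in DD.
have e : Qprod w D * (Qprod w L * Qprod w D) = Qprod w L * Qprod w D.
  by rewrite mulrA cD -mulrA DD.
by rewrite LL' -[in RHS](mulrA (Qprod w L) _ x) cx -!mulrA e.
Qed.

Section Integrals.
Variable c : R[i] -> R.
Hypothesis cD : {morph c : y z / y + z}.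
Hypothesis c0 : c 0 = 0.
Hypothesis cZ : forall z (r : R), c (z * r%:C) = c z * r.
Hypothesis c_norm : forall z, `|c z| <= complex.Re `|z|.

Let Omega_measurable : measurable (Omega F eps).
Proof. exact: (path_space_measurable (Omega_ F eps)). Qed.

(** Dominated convergence, in the form in which it is used for both passages to the
    limit; [c] stands for the real or the imaginary part. *)
Lemma bounded_limit (f : nat -> paths A -> R[i]) (g : paths A -> R[i]) (K : R)
    (a : nat -> R) (l : R) :
  (forall i, measurable_fun (Omega F eps) (fun w => c (f i w) : R)) ->
  (forall w, Omega F eps w -> forall e : R, 0 < e ->
     exists N, forall i, (N <= i)%N -> `|f i w - g w| < e%:C) ->
  (forall i w, Omega F eps w -> `|f i w| <= K%:C) ->
  (forall i, (\int[mu]_(w in Omega F eps) (c (f i w))%:E = (a i)%:E)%E) ->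
  a @ \oo --> l ->
  mu.-integrable (Omega F eps) (fun w => (c (g w))%:E) /\
  (\int[mu]_(w in Omega F eps) (c (g w))%:E = l%:E)%E.
Proof.
move=> mf fg fK fa al.
pose f' i w : \bar R := (c (f i w))%:E; pose g' w : \bar R := (c (g w))%:E.
have mf' i : measurable_fun (Omega F eps) (f' i) by apply/measurable_EFinP; exact: mf.
have cN z : c (- z) = - c z by apply/eqP; rewrite -addr_eq0 -cD addNr c0.
have fcvg w : Omega F eps w -> f' ^~ w @ \oo --> g' w.
  move=> wO; apply: cvg_EFin; first by apply: nearW.
  apply/cvgrPdist_lt => e e0; have [N NP] := fg w wO e e0.
  exists N => // i Ni /=; rewrite distrC -cN -cD; apply: le_lt_trans (c_norm _) _.
  by rewrite -ltcR RRe_real ?normr_real//; exact: NP.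
have mg : measurable_fun (Omega F eps) g' by apply: (emeasurable_fun_cvg f' g').
have iK : mu.-integrable (Omega F eps) (EFin \o cst K).
  exact: finite_measure_integrable_cst.
have f'g' : {ae mu, forall w, Omega F eps w -> f' ^~ w @ \oo --> g' w}.
  by apply: aeW => w; exact: fcvg.
have f'K : {ae mu, forall w, forall i, Omega F eps w -> (`|f' i w| <= (EFin \o cst K) w)%E}.
  apply: aeW => w i wO /=; rewrite lee_fin; apply: le_trans (c_norm _) _.
  by rewrite -lecR RRe_real ?normr_real//; exact: fK.
have [ig _ lim] := dominated_convergence Omega_measurable mf' mg f'g' iK f'K.
split=> //; apply: (cvg_unique _ lim) => //.
have -> : (fun n => \int[mu]_(w in Omega F eps) f' n w)%E = EFin \o a.
  by apply/funext => n; exact: fa.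
by apply: cvg_EFin => //; exact: nearW.
Qed.

Section Fibres.
Variables (B : paths A -> cstarType R) (io : forall w, {fset int} -> A -> B w).
Variables (Ew : forall w, A -> B w) (psi : forall w, B w -> R[i]).
Hypothesis Ew_map : forall w, Omega F eps w -> corner_map F w (@io w) (@Ew w).
Hypothesis psi_state : forall w, Omega F eps w ->
    fibre_state F phi eps calE w (@io w) (@psi w).

Let psiE x w : R[i] := psi (Ew w x).

Lemma psiE_dist w x y : Omega F eps w -> `|psiE x w - psiE y w| <= (cnorm (x - y))%:C.
Proof.
move=> wO; have [lE _ _ nE _] := Ew_map wO; have [lp np _ _] := psi_state wO.
have -> : psiE x w - psiE y w = psi (Ew w (x - y)).
  have := lp (-1) (Ew w y) (Ew w x); rewrite mulN1r addrC => <-.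
  by have := lE (-1) y x; rewrite !scaleN1r [- y + x]addrC => ->.
by apply: le_trans (np _) _; rewrite lecR.
Qed.

Lemma psiE_le w x : Omega F eps w -> `|psiE x w| <= (cnorm x)%:C.
Proof.
move=> wO; have := psiE_dist x 0 wO; rewrite subr0.
suff -> : psiE 0 w = 0 by rewrite subr0.
have [lE _ _ _ _] := Ew_map wO; have [lp _ _ _] := psi_state wO.
have E0 : Ew w 0 = 0.
  by have := lE (-1) 0 0; rewrite scaler0 addr0 scaleN1r addNr.
by rewrite /psiE E0; have := lp (-1) 0 0; rewrite scaler0 addr0 mulN1r addNr.
Qed.

(** The value of the fibre state is by definition a limit of such numbers, and the
    chosen segments are cofinal. *)
Lemma psiE_limit w k0 n0 x : Omega F eps w -> k0 \in I -> n0 \in I -> k0 <= n0 ->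
  alg_seg F k0 n0 x -> forall e : R, 0 < e -> exists N, forall i, (N <= i)%N ->
  `|cut_psi (descend k0 i) (absz (ascend n0 i - descend k0 i)%R) x w - psiE x w| < e%:C.
Proof.
move=> wO k0I n0I kn0 xL e e0; set L := seg k0 n0.
have LI : finite_sites F L.
  by move=> j; rewrite mem_seg//; exact: sites_convex.
have xL' : alg F [set` L] x by rewrite -alg_segE.
have [_ _ _ _ EL] := Ew_map wO; have [_ _ _ lim] := psi_state wO.
have cb : corner F w L (Qprod w L * x * Qprod w L) by exists x.
have [k1 [n1 [k1I n1I h]]] := lim L _ LI cb e e0.
have [N1 N1P] := descend_le k0I k1I; have [N2 N2P] := ascend_le n0I n1I.
exists (maxn N1 N2) => i; rewrite geq_max => /andP[/N1P ki /N2P ni].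
have [kI kk0] := descend_sites i k0I; have [nI nn0] := ascend_sites i n0I.
set k := descend k0 i in ki kI kk0 *; set n := ascend n0 i in ni nI nn0 *.
set m := absz (n - k)%R; have nE : n = k + m%:Z by rewrite /m; lia.
have kn : k <= n by lia.
have Lkn : (L `<=` seg k n)%fset.
  by apply/fsubsetP => j; rewrite !mem_seg//; lia.
have := h k n kI nI ki ni kn Lkn; rewrite -EL// nE corner_extend//; last by rewrite -nE.
rewrite nE in nI; rewrite local_psiE//.
have an := algA F [set j | j <= k + m%:Z].
have nq : alg_le F (k + m%:Z) (Qlist w (int_seq k m.+1)).
  by apply: (Qlist_alg wO) => j; rewrite mem_int_seq /=; lia.
have nx : alg_le F (k + m%:Z) x by apply: alg_sub xL => j /=; lia.
by apply: (subalgM an) => //; exact: (subalgM an).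
Qed.

Lemma decomposition_local k0 n0 x : k0 \in I -> n0 \in I -> k0 <= n0 ->
  alg_seg F k0 n0 x ->
  mu.-integrable (Omega F eps) (fun w => (c (psiE x w))%:E) /\
  (\int[mu]_(w in Omega F eps) (c (psiE x w))%:E = (c (phi x))%:E)%E.
Proof.
move=> k0I n0I kn0 xL.
pose f i := cut_psi (descend k0 i) (absz (ascend n0 i - descend k0 i)%R) x.
have fI i : [/\ descend k0 i \in I, descend k0 i + (absz (ascend n0 i - descend k0 i)%R)%:Z
    \in I
    & alg_le F (descend k0 i + (absz (ascend n0 i - descend k0 i)%R)%:Z) x].
  have [kI kk0] := descend_sites i k0I; have [nI nn0] := ascend_sites i n0I.
  have -> : descend k0 i + (absz (ascend n0 i - descend k0 i)%R)%:Z = ascend n0 i by lia.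
  by split=> //; apply: alg_sub xL => j /=; lia.
apply: (@bounded_limit f (psiE x) (cnorm x) (fun=> c (phi x))).
- move=> i; apply: measurable_funTS.
  apply: (@local_measurable _ _ _ (descend k0 i) (absz (ascend n0 i - descend k0 i)%R).+1).
  by move=> v w /cut_psi_cylinder vw; rewrite /f vw.
- by move=> w wO; exact: psiE_limit.
- by move=> i w wO; have [kI nI _] := fI i; exact: cut_psi_le.
- by move=> i; have [kI nI nx] := fI i; exact: integral_cut_psi.
- exact: cvg_cst.
Qed.

Let localized : set A :=
  [set x | exists k n, [/\ k \in I, n \in I, k <= n & alg_seg F k n x]].

(** The localized elements form a *-algebra, as two segments lie in a common one,
    and it contains the generators. *)
Lemma localized_dense : closure_of localized = setT.
Proof.
suff sub : setT `<=` closure_of localized by apply/seteqP; split.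
rewrite -(car_gen F); apply: cstar_gen_closure.
  have join x y : localized x -> localized y -> exists k n,
      [/\ k \in I, n \in I, k <= n, alg_seg F k n x & alg_seg F k n y].
    move=> [k [n [kI nI kn xk]]] [k' [n' [kI' nI' kn' yk]]].
    exists (Num.min k k'), (Num.max n n'); split.
    + by rewrite /Num.min; case: ifP.
    + by rewrite /Num.max; case: ifP.
    + by rewrite ge_min le_max kn.
    + apply: alg_sub xk => j /=; lia.
    + apply: alg_sub yk => j /=; lia.
  have [j jI] := sites_neq0 F.
  split.
  - by exists j, j; split=> //; exact: (subalg1 (algA F _)).
  - move=> a y z ly lz; have [k [n [kI nI kn yk zk]]] := join y z ly lz.
    exists k, n; split=> //; have ak := algA F [set j | k <= j <= n].
    by apply: (subalgD ak) => //; exact: (subalgZ ak).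
  - move=> y z ly lz; have [k [n [kI nI kn yk zk]]] := join y z ly lz.
    exists k, n; split=> //; exact: (subalgM (algA F [set j | k <= j <= n])).
  - move=> y [k [n [kI nI kn yk]]]; exists k, n; split=> //.
    exact: (subalg_star (algA F [set j | k <= j <= n])).
move=> _ [j jI [i ->]]; exists j, j; split=> //.
by apply: alg_ann => //=; rewrite lexx.
Qed.

(** The functionals of the fibres are contractions, so the approximation of [x] by
    localized elements is uniform over the path space. *)
Lemma decomposition x :
  mu.-integrable (Omega F eps) (fun w => (c (psiE x w))%:E) /\
  (\int[mu]_(w in Omega F eps) (c (psiE x w))%:E = (c (phi x))%:E)%E.
Proof.
have : closure_of localized x by rewrite localized_dense.
move=> /closure_ofP dense.
have {}dense n : exists y, localized y /\ cnorm (y - x) < n.+1%:R^-1.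
  by have [|y ly yx] := dense n.+1%:R^-1; [rewrite invr_gt0|exists y].
have [u uP] := choice dense.
have [ul ux] : (forall n, localized (u n)) /\ (forall n, cnorm (u n - x) < n.+1%:R^-1).
  by split=> n; case: (uP n).
have uint n := let: ex_intro k (ex_intro m (And4 kI mI km xk)) := ul n in
  decomposition_local kI mI km xk.
have nbd n : cnorm (u n) <= cnorm x + 1.
  have := cnormD (u n - x) x; rewrite subrK => /le_trans; apply.
  rewrite addrC lerD2l; apply: le_trans (ltW (ux n)) _.
  by rewrite invf_le1 ?ler1n.
apply: (@bounded_limit (fun n => psiE (u n)) (psiE x) (cnorm x + 1) (fun n => c (phi (u n)))).
- move=> n; have [/integrableP[+ _] _] := uint n.
  by move=> /measurable_EFinP.
- move=> w wO e e0.
  have [N _ NP] := cvgr0_norm_lt _ (@cvg_harmonic R) _ e0.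
  exists N => n Nn; apply: le_lt_trans (psiE_dist _ _ wO) _; rewrite ltcR.
  apply: lt_trans (ux n) _; apply: le_lt_trans (NP n Nn); exact: ler_norm.
- by move=> n w wO; apply: le_trans (psiE_le _ wO) _; rewrite lecR.
- by move=> n; case: (uint n).
apply/cvgrPdist_lt => e e0; have [N _ NP] := cvgr0_norm_lt _ (@cvg_harmonic R) _ e0.
exists N => // n Nn /=.
have cN z : c (- z) = - c z by apply/eqP; rewrite -addr_eq0 -cD addNr c0.
rewrite distrC -cN -cD; apply: le_lt_trans (c_norm _) _.
rewrite -ltcR RRe_real ?normr_real//; apply: le_lt_trans (state_dist phi_state _ _) _.
by rewrite ltcR; apply: lt_trans (ux n) _; apply: le_lt_trans (NP n Nn); exact: ler_norm.
Qed.

End Fibres.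
End Integrals.
End PathMeasure.
End Markov.

Theorem theorem3p2 (R : realType) (A : cstarType R) (F : fermion A)
  (phi : A -> R[i]) (E eps calE : int -> A -> A)
  (phi_markov : markov_state_with F phi E)
  (phi_faithful : locally_faithful F phi)
  (eps_trans : transition_expectations F E eps)
  (calE_cond : markov_cond_expectations F eps calE)
  (mu : probability (paths A) R)
  (mu_law : markov_law F phi eps mu)
  (B : paths A -> cstarType R)
  (io : forall w : paths A, {fset int} -> A -> B w)
  (B_lim : forall w, Omega F eps w -> inductive_limit F w (io w))
  (Ew : forall w : paths A, A -> B w)
  (Ew_map : forall w, Omega F eps w -> corner_map F w (io w) (Ew w))
  (psi : forall w : paths A, B w -> R[i])
  (psi_state : forall w, Omega F eps w ->
     fibre_state F phi eps calE w (io w) (psi w))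
  (x : A) :
  complex_integrable F eps mu (fun w => psi w (Ew w x)) /\
  phi x = complex_integral F eps mu (fun w => psi w (Ew w x)).
Proof.
have norm_Re (z : R[i]) : `|complex.Re z| <= complex.Re `|z|.
  by have := normc_ge_Re z; rewrite -{1}(RRe_real (normr_real z)) lecR.
have norm_Im (z : R[i]) : `|complex.Im z| <= complex.Re `|z|.
  by case: z => a b /=; rewrite -sqrtr_sqr ler_wsqrtr// lerDr sqr_ge0.
have ReZ (z : R[i]) (r : R) : complex.Re (z * r%:C) = complex.Re z * r.
  by case: z => a b; rewrite /= mulr0 subr0.
have ImZ (z : R[i]) (r : R) : complex.Im (z * r%:C) = complex.Im z * r.
  by case: z => a b; rewrite /= mulr0 add0r.
have [iRe eRe] := decomposition phi_markov phi_faithful eps_trans calE_cond mu_law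
  (raddfD (@complex.Re R)) (erefl _) ReZ norm_Re Ew_map psi_state x.
have [iIm eIm] := decomposition phi_markov phi_faithful eps_trans calE_cond mu_law
  (raddfD (@complex.Im R)) (erefl _) ImZ norm_Im Ew_map psi_state x.
split; first by split.
by rewrite /complex_integral /Rintegral eRe eIm /=; case: (phi x).
Qed.
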